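(* Fix integers $r \ge 1$, $k \ge 1$, and $b \ge 0$ such that $\binom{2k+2b}{2k} \le r < \binom{2k+2b+2}{2k}$. Then $$\sum_{\pi} x^{|\pi|} = \sum \prod_{i=0}^b \binom{d_i+d_{i-1}+l_i-1}{d_i+l_i}\binom{d_i+l_i}{l_i} \cdot \frac{\left(U_k\left(\frac{1-x}{2x}\right)\right)^{d_0+l_0-1}}{\left(U_{k+1}\left(\frac{1-x}{2x}\right) + U_k\left(\frac{1-x}{2x}\right)\right)^{d_0+l_0+1}}\, x^{-1-d_0-l_0+\sum_{j=0}^b (2d_j+l_j)}.$$ Here the sum on the left is over all involutions $\pi \in I(3412)$ which contain exactly $r$ subsequences of type $2k+1\ \ldots\ 2\ 1$ (that is, exactly $r$ decreasing subsequences of length $2k+1$). The sum on the right is over all sequences $d_0, \ldots, d_b$ and $l_0, \ldots, l_b$ of nonnegative integers such that $$r = \sum_{i=0}^b d_i\left( \binom{2k+2i+1}{2k} + \binom{2k+2i}{2k}\right) + \sum_{i=0}^b l_i\binom{2k+2i}{2k},$$ and $d_{-1} = 1$.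
   Context: $I(3412)$ denotes the set of all involutions (of all lengths $n\ge 0$, including the empty permutation), in one-line notation, which avoid $3412$, i.e. have no subsequence in the same relative order as $3412$. $|\pi|$ is the length of $\pi$. $U_n(x)$ is the $n$th Chebyshev polynomial of the second kind: $U_{-1}(x)=0$ and $U_n(\cos t) = \frac{\sin((n+1)t)}{\sin t}$ for $n \ge 0$. Binomial conventions: $\binom{a}{0}=1$ and $\binom{a}{-1}=0$ for any integer $a$, and $\binom{a}{m}=0$ for integers $0 \le a < m$. *)

(* Defs.v *)
From HB Require Import structures.
From mathcomp Require Import all_boot all_order all_fingroup all_algebra.
From mathcomp Require Import boolp classical_sets reals trigo.

Set Implicit Arguments.
Unset Strict Implicit.
Unset Printing Implicit Defensive.

Import Order.TTheory GRing.Theory Num.Theory.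

(* A pattern is given in one-line notation by a sequence [p] of distinct
   numbers.  An occurrence of [p] in [s] is a strictly increasing choice [f] of
   positions such that the subsequence s (f 0), s (f 1), ... is in the same
   relative order as [p]. *)
Definition occurrences (n : nat) (s : 'S_n) (p : seq nat) :
    {set {ffun 'I_(size p) -> 'I_n}} :=
  [set f : {ffun 'I_(size p) -> 'I_n} |
    [forall i : 'I_(size p), forall j : 'I_(size p),
       (i < j)%N ==> (f i < f j)%N] &&
    [forall i : 'I_(size p), forall j : 'I_(size p),
       (s (f i) < s (f j))%N == (nth 0%N p i < nth 0%N p j)%N]].

Definition avoids (n : nat) (s : 'S_n) (p : seq nat) : bool :=
  occurrences s p == finset.set0.

(* 2k+1 ... 2 1 when m = 2k+1 *)
Definition decreasing_pattern (m : nat) : seq nat := rev (iota 1 m).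

(* The involutions of length n in I(3412); the identity is an involution, and
   for n = 0 the empty permutation is the only element. *)
Definition I3412 (n : nat) : {set 'S_n} :=
  [set s : 'S_n | [forall i, s (s i) == i] && avoids s [:: 3; 4; 1; 2]%N].

Definition I3412_count (m r n : nat) : nat :=
  #|[set s in I3412 n | #|occurrences s (decreasing_pattern m)| == r]|.

Local Open Scope ring_scope.

Notation fracX R := (tofrac ('X : {poly R})).

(* [f] is the formal power series sum_n a_n X^n: writing f = p / q, the product
   of q with this series is p.  Since R[[X]] is an integral domain containing
   R[X], this is equality in the fraction field of R[[X]], i.e. equality of
   Laurent series, and it does not depend on the choice of p and q. *)
Definition is_power_series (R : fieldType) (a : nat -> R)
    (f : {fraction {poly R}}) : Prop :=
  exists p q : {poly R}, [/\ q != 0, f = tofrac p / tofrac q &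
    forall n : nat, \sum_(i < n.+1) q`_i * a (n - i)%N = p`_n].

Definition is_chebyshevU (R : realType) (n : nat) (u : {poly R}) : Prop :=
  forall t : R, sin t != 0 -> u.[cos t] = sin (n.+1%:R * t) / sin t.

Definition chebyshevU (R : realType) (n : nat) : {poly R} :=
  xget 0 [set u : {poly R} | is_chebyshevU n u]%classic.

(* The default value of [xget] is never used. *)
Lemma chebyshevUP (R : realType) (n : nat) : is_chebyshevU n (chebyshevU R n).
Proof.
apply: (@xgetPex _ _ [set u : {poly R} | is_chebyshevU n u]%classic).
suff [u [v [hu _]]] : exists u v : {poly R},
    is_chebyshevU n u /\ is_chebyshevU n.+1 v by exists u.
elim: n => [|n [u [v [hu hv]]]].
  exists 1, ('X *+ 2); split=> t st0.
    by rewrite hornerE mul1r divff.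
  rewrite hornerMn hornerX.
  have -> : 2%:R * t = t + t by rewrite mulr_natl mulr2n.
  by rewrite sinD [cos t * _]mulrC -mulr2n -mulrnAr mulrAC divff // mul1r.
exists v, ('X *+ 2 * v - u); split=> // t st0.
rewrite hornerD hornerN hornerM hornerMn hornerX hu // hv // mulrA -mulrBl.
congr (_ / _).
have -> : n.+3%:R * t = n.+2%:R * t + t by rewrite -[in LHS]natr1 mulrDl mul1r.
have -> : n.+1%:R * t = n.+2%:R * t - t.
  by rewrite -[in RHS]natr1 mulrDl mul1r addrK.
rewrite sinB sinD mulrnAl mulr2n [cos t * _]mulrC opprB addrC.
by rewrite addrA subrK addrC.
Qed.

(* U_n((1 - x) / (2 x)) as a rational function of x *)
Definition chebyshevU_frac (R : realType) (n : nat) : {fraction {poly R}} :=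
  (map_poly (fun c : R => tofrac c%:P) (chebyshevU R n)).[
     (1 - fracX R) / (2 * fracX R)].

Definition dl_weight (k b : nat) (d l : 'I_b.+1 -> nat) : nat :=
  (\sum_(i < b.+1)
      d i * ('C(2 * k + 2 * i + 1, 2 * k) + 'C(2 * k + 2 * i, 2 * k))
   + \sum_(i < b.+1) l i * 'C(2 * k + 2 * i, 2 * k))%N.

(* The sequences of weight r have entries at most r, so that a sum over all of
   them can be indexed by sequences with entries in 'I_r.+1. *)
Lemma dl_weight_bound (k b : nat) (d l : 'I_b.+1 -> nat) (i : 'I_b.+1) :
  (d i <= dl_weight k d l)%N && (l i <= dl_weight k d l)%N.
Proof.
have C0 : (0 < 'C(2 * k + 2 * i, 2 * k))%N by rewrite bin_gt0 leq_addr.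
apply/andP; split.
  apply: leq_trans (leq_addr _ _); rewrite (bigD1 i) //=.
  apply: leq_trans (leq_addr _ _); apply: leq_pmulr.
  exact: leq_trans C0 (leq_addl _ _).
apply: leq_trans (leq_addl _ _); rewrite (bigD1 i) //=.
by apply: leq_trans (leq_addr _ _); apply: leq_pmulr.
Qed.

(* d_{i-1}, with d_{-1} = 1 *)
Definition dprev (b : nat) (d : 'I_b.+1 -> nat) (i : 'I_b.+1) : nat :=
  if i == 0%N :> nat then 1%N else d (inord i.-1).

(* The truncated subtraction is harmless: d_i + d_{i-1} + l_i - 1 is negative
   only if d_i + l_i = 0, and then the binomial coefficient is 1 by the
   convention 'C(a, 0) = 1. *)
Definition dl_coef (b : nat) (d l : 'I_b.+1 -> nat) : nat :=
  (\prod_(i < b.+1)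
    ('C(d i + dprev d i + l i - 1, d i + l i) * 'C(d i + l i, l i)))%N.

(* Main.v *)
From HB Require Import structures.
Require Import Defs.
From mathcomp Require Import all_boot all_order all_fingroup all_algebra reals.
From mathcomp Require Import boolp functions trigo zify ring.

Set Implicit Arguments.
Unset Strict Implicit.
Import Order.TTheory GRing.Theory Num.Theory.

(** A 3412-avoiding involution is exactly a noncrossing one: the intervals
    between i and s i never cross.  It is therefore a Motzkin path, in which an
    arc is an up step together with the matching down step, and a fixed point is
    a level step.  The height at which such a step is taken is the number
    [depth s i] of arcs strictly over it.

    A set of positions is decreasing for such an s exactly when the intervals of
    its elements form a chain.  Sorting decreasing sets by their innermost
    interval, each fixed point at height h accounts for 'C(2h, m) decreasing
    sets with m + 1 elements, and each arc at height h for
    'C(2h + 1, m) + 'C(2h, m) of them ([card_decreasing_on]).  With m = 2k,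
    steps below height k count for nothing, and the steps at height k + i have
    the weights that appear in [dl_weight].  The bound on r leaves no room for
    a step above height k + b.  It remains to enumerate, for every choice of
    the numbers d of arcs and l of fixed points at each height >= k, the paths
    with that profile ([I3412_count_by_profile]).

    To have a recursion, paths are allowed to start at any height h: an
    involution whose first h positions are all opened and not yet closed
    ([open_involutions]).  Looking at position h gives the three possible first
    steps, and removing that step gives the linear recursion
    [count_profileS].

    In terms of generating functions this recursion is a linear system over the
    polynomials in X.  Below height k all steps are free, so the system is
    tridiagonal with constant coefficients; Gaussian elimination
    ([strip_elimination]) produces the continuants [strip_poly], which are
    Chebyshev polynomials of the second kind in (1 - X) / 2X up to a power of X
    ([tofrac_strip_poly]).  From height k on, the profile decreases at each step
    that is not a descent.  Writing N for the number of steps at height k, the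
    lower part contributes N + 1 excursions below height k, each with the
    denominator [strip_den], and the number of ways to arrange the upper part is
    the product of trinomial coefficients [profile_coef], because that product
    obeys the same recursion by Pascal's rule ([profile_coef_step]).  This is
    [profile_series_formula]. *)

(** * Decreasing subsequences as sets of positions *)

Definition decreasing_on n (s : 'S_n) (A : {set 'I_n}) : bool :=
  [forall i in A, forall j in A, (i < j)%N ==> (s j < s i)%N].

Lemma decreasing_onP n (s : 'S_n) (A : {set 'I_n}) :
  reflect (forall i j : 'I_n, i \in A -> j \in A -> (i < j)%N -> (s j < s i)%N)
          (decreasing_on s A).
Proof.
apply: (iffP forall_inP) => [H i j iA jA ij|H i iA].
  by have /forall_inP/(_ j jA)/implyP/(_ ij) := H i iA.
by apply/forall_inP => j jA; apply/implyP; apply: H.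
Qed.

Lemma sorted_enum_ord n : sorted (fun i j : 'I_n => (i < j)%N) (enum 'I_n).
Proof.
have := iota_ltn_sorted 0 n; rewrite -val_enum_ord sorted_map.
by [].
Qed.

Lemma sorted_enum_set n (A : {set 'I_n}) :
  sorted (fun i j : 'I_n => (i < j)%N) (enum A).
Proof.
rewrite {1}/enum_mem sorted_filter // => [x y z|]; first exact: ltn_trans.
by rewrite -enumT; apply: sorted_enum_ord.
Qed.

Lemma nth_decreasing_pattern m i : (i < m)%N ->
  nth 0%N (decreasing_pattern m) i = (m - i)%N.
Proof. by move=> im; rewrite nth_rev ?size_iota // nth_iota; lia. Qed.

Lemma occurrences_decreasingP n (s : 'S_n) m
    (f : {ffun 'I_(size (decreasing_pattern m)) -> 'I_n}) :
  reflect
    ((forall i j : 'I_(size (decreasing_pattern m)),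
        (i < j)%N -> (f i < f j)%N) /\
     (forall i j : 'I_(size (decreasing_pattern m)),
        (i < j)%N -> (s (f j) < s (f i))%N))
          (f \in occurrences s (decreasing_pattern m)).
Proof.
have sz : size (decreasing_pattern m) = m by rewrite size_rev size_iota.
have P (i j : 'I_(size (decreasing_pattern m))) :
   (nth 0%N (decreasing_pattern m) i < nth 0%N (decreasing_pattern m) j)%N
   = (j < i)%N.
  have := ltn_ord i; have := ltn_ord j; rewrite {2 4}sz => jm im.
  by rewrite !nth_decreasing_pattern //; lia.
rewrite inE; apply: (iffP andP) => [[/forallP H1 /forallP H2]|[H1 H2]]; split.
- by move=> i j ij; have /forallP/(_ j)/implyP := H1 i; apply.
- by move=> i j ij; have /forallP/(_ i)/eqP := H2 j; rewrite P ij.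
- by apply/forallP => i; apply/forallP => j; apply/implyP; apply: H1.
apply/forallP => i; apply/forallP => j; apply/eqP; rewrite P.
have [ij|ji|/val_inj ->] := ltngtP i j; last by rewrite ltnn.
  by have := H2 _ _ ij; lia.
by rewrite H2.
Qed.

(** An increasing choice of positions is determined by its range, and any set
    with the right number of elements is such a range. *)
Lemma card_occurrences_decreasing n (s : 'S_n) m :
  #|occurrences s (decreasing_pattern m)|
  = #|[set A : {set 'I_n} | decreasing_on s A & #|A| == m]|.
Proof.
have sz : size (decreasing_pattern m) = m by rewrite size_rev size_iota.
set q := size _ in sz *.
have q_inj (f : {ffun 'I_q -> 'I_n}) :
    (forall i j : 'I_q, (i < j)%N -> (f i < f j)%N) -> injective f.
  move=> H i j fij; have [ij|ji|/val_inj//] := ltngtP i j.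
    by have := H _ _ ij; rewrite fij ltnn.
  by have := H _ _ ji; rewrite fij ltnn.
rewrite -(card_in_imset
  (f := fun f : {ffun 'I_q -> 'I_n} => [set f i | i : 'I_q])).
  congr #|pred_of_set _|; apply/setP => A; rewrite inE; apply/imsetP/andP.
    move=> [f /occurrences_decreasingP [H1 H2] ->]; split.
      apply/decreasing_onP => _ _ /imsetP[i _ ->] /imsetP[j _ ->] ij.
      have [/H2//|/H1 ji|/val_inj eij] := ltngtP i j.
        by have := ltn_trans ij ji; rewrite ltnn.
      by move: ij; rewrite eij ltnn.
    by rewrite card_imset ?card_ord ?sz //; apply: q_inj.
  move=> [/decreasing_onP H /eqP cA].
  have lt i : (i < q)%N -> (i < size (enum A))%N by rewrite -cardE cA sz.
  (* [i0] is only the default value of [nth] *)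
  have [i0|] := pickP 'I_n; last first.
    move=> n0; have A0 : A = set0 by apply/setP => x; have := n0 x.
    have m0 : q = 0%N by rewrite sz -cA A0 cards0.
    have f : {ffun 'I_q -> 'I_n}.
      by apply: ffun0; rewrite card_ord.
    exists f; last first.
      by apply/setP=> x; have := n0 x.
    by apply/occurrences_decreasingP; split=> i; have := ltn_ord i; lia.
  move=> _; pose f := [ffun i : 'I_q => nth i0 (enum A) i].
  have fA i : f i \in A by rewrite ffunE -mem_enum mem_nth // lt.
  have f_inc (i j : 'I_q) : (i < j)%N -> (f i < f j)%N.
    move=> ij; rewrite !ffunE.
    apply: (sorted_ltn_nth (leT := fun i j : 'I_n => (i < j)%N)) => //.
    - by move=> x y z; apply: ltn_trans.
    - exact: sorted_enum_set.
    - exact: lt.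
    - exact: lt.
  exists f.
    apply/occurrences_decreasingP; split => // i j ij.
    by apply: H => //; apply: f_inc.
  apply/esym/eqP; rewrite eqEcard card_imset ?card_ord ?cA; last exact: q_inj.
  apply/andP; split; last by lia.
  by apply/subsetP => _ /imsetP[i _ ->].
move=> f g /occurrences_decreasingP[Hf _] /occurrences_decreasingP[Hg _] /= fg.
(* both maps list the same set in increasing order *)
have srt (h : {ffun 'I_q -> 'I_n}) :
    (forall i j : 'I_q, (i < j)%N -> (h i < h j)%N) ->
    sorted (fun i j : 'I_n => (i < j)%N) (codom h).
  by move=> hh; apply: homo_sorted (sorted_enum_ord q) => i j; apply: hh.
have e : codom f = codom g.
  apply: (irr_sorted_eq (leT := fun i j : 'I_n => (i < j)%N)).
  - by move=> x y z; apply: ltn_trans.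
  - by move=> x; rewrite ltnn.
  - exact: srt.
  - exact: srt.
  move=> x; apply/codomP/codomP => -[i ->].
    have : f i \in [set f i | i : 'I_q] by rewrite imset_f.
    by rewrite fg => /imsetP[j _ ->]; exists j.
  have : g i \in [set g i | i : 'I_q] by rewrite imset_f.
  by rewrite -fg => /imsetP[j _ ->]; exists j.
apply/ffunP => i.
have := congr1 (fun t => nth (f i) t (enum_rank i)) e.
by rewrite !nth_codom !enum_rankK.
Qed.

(** * Noncrossing involutions and the weights of their steps *)

Definition noncrossing n (s : 'S_n) : bool :=
  [forall i : 'I_n, forall j : 'I_n, ~~ [&& i < j, j < s i & s i < s j]%N].

Lemma noncrossingP n (s : 'S_n) :
  reflect (forall i j : 'I_n,
             (i < j)%N -> (j < s i)%N -> (s i < s j)%N -> False)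
          (noncrossing s).
Proof.
apply: (iffP forallP) => [H i j ij ji sij|H i].
  by have /forallP/(_ j)/negP := H i; apply; apply/and3P.
by apply/forallP => j; apply/negP => /and3P[]; apply: H.
Qed.

Definition involution n (s : 'S_n) : bool := [forall i, s (s i) == i].

Lemma involutionP n (s : 'S_n) : reflect (forall i, s (s i) = i) (involution s).
Proof. exact: eqfunP. Qed.

(** A crossing i < j < s i < s j is an occurrence of 3412 at these four
    positions.  Conversely an occurrence at a < b < c < d yields a crossing of
    the intervals of a and b if b < s a, and of those of c and d otherwise. *)
Lemma in_I3412 n (s : 'S_n) :
  (s \in I3412 n) = involution s && noncrossing s.
Proof.
rewrite inE -/(involution s); case: involutionP => //= inv.
apply/eqP/noncrossingP => [av i j ij jsi sij|nc].
  pose f : {ffun 'I_4 -> 'I_n} := [ffun x => nth i [:: i; j; s i; s j] (val x)].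
  have : f \in occurrences s [:: 3; 4; 1; 2]%N.
    rewrite inE; apply/andP; split;
      apply/forallP => -[[|[|[|[|//]]]] hx];
      apply/forallP => -[[|[|[|[|//]]]] hy];
      rewrite !ffunE //= ?inv //=; lia.
  by rewrite av inE.
apply/setP => f; rewrite !inE; apply/negP => /andP[/forallP H1 /forallP H2].
pose o (x : nat) (h : (x < 4)%N) : 'I_4 := Ordinal h.
pose a := f (@o 0 isT); pose b := f (@o 1 isT).
pose c := f (@o 2 isT); pose d := f (@o 3 isT).
have ab : (a < b)%N by have /forallP/(_ (@o 1 isT)) := H1 (@o 0 isT).
have bc : (b < c)%N by have /forallP/(_ (@o 2 isT)) := H1 (@o 1 isT).
have cd : (c < d)%N by have /forallP/(_ (@o 3 isT)) := H1 (@o 2 isT).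
have sab : (s a < s b)%N.
  by have /forallP/(_ (@o 1 isT))/eqP -> := H2 (@o 0 isT).
have sda : (s d < s a)%N.
  by have /forallP/(_ (@o 0 isT))/eqP -> := H2 (@o 3 isT).
have scd : (s c < s d)%N.
  by have /forallP/(_ (@o 3 isT))/eqP -> := H2 (@o 2 isT).
have sa_b : (s a < b)%N.
  have [//|bsa|/val_inj e] := ltngtP (s a) b.
    by case: (nc _ _ ab bsa sab).
  by move: ab sab; rewrite -e inv; lia.
by apply: (nc (s c) (s d) scd); rewrite !inv; lia.
Qed.

Definition arc_min n (s : 'S_n) (x : 'I_n) : 'I_n :=
  if (x <= s x)%N then x else s x.

(** When s is read as a Motzkin path, this is the height of step i, provided
    that i opens an arc or is a fixed point. *)
Definition depth n (s : 'S_n) (i : 'I_n) : nat :=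
  \sum_(j < n) (j < i < s j)%N.

Definition strictly_over n (s : 'S_n) (i : 'I_n) : {set 'I_n} :=
  [set j : 'I_n | (j < i < s j)%N || (s j < i < j)%N].

Lemma card_strictly_over n (s : 'S_n) (i : 'I_n) :
  involution s -> #|strictly_over s i| = (2 * depth s i)%N.
Proof.
move=> /involutionP inv.
pose openers := [set j : 'I_n | j < i < s j]%N.
have -> : strictly_over s i = openers :|: [set j : 'I_n | s j < i < j]%N.
  by apply/setP => j; rewrite !inE.
rewrite cardsU.
have -> : openers :&: [set j : 'I_n | s j < i < j]%N = set0.
  by apply/setP => j; rewrite !inE; lia.
rewrite cards0 subn0.
have -> : [set j : 'I_n | s j < i < j]%N = s @: openers.
  apply/setP => j; rewrite inE; apply/idP/imsetP => [h|[x + ->]].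
    by exists (s j); rewrite ?inE inv.
  by rewrite inE inv.
rewrite card_imset; last exact: perm_inj.
rewrite /depth addnn -mul2n; congr (2 * _)%N.
rewrite -sum1_card big_mkcond /=; apply: eq_bigr => j _.
by rewrite inE; case: ifP.
Qed.

(** On two positions, s decreases exactly when one of their intervals contains
    the other.  Hence the element of a decreasing set whose interval starts last
    has the innermost interval; if this starts at i, all other elements are
    ends of intervals around i.  Conversely, all intervals around i are nested
    because they do not cross. *)
Lemma decreasing_on_innermost n (s : 'S_n) (i : 'I_n) (A : {set 'I_n}) :
  involution s -> noncrossing s -> (i <= s i)%N ->
  (A \subset strictly_over s i :|: [set i; s i])
    && ~~ (A \subset strictly_over s i)
  = [&& decreasing_on s A, [exists x in A, arc_min s x == i] &
        [forall x in A, arc_min s x <= i]%N].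
Proof.
move=> /involutionP inv /noncrossingP nc isi.
have eq_val (x y : 'I_n) : x = y :> nat -> x = y by move/val_inj.
apply/andP/and3P.
  move=> [/subsetP AC AE]; split.
  - apply/decreasing_onP => x y /AC + /AC; rewrite !inE => hx hy xy.
    have hx' : ((x <= i <= s x) || (s x <= i <= x))%N.
      case/or3P: hx => [|/eqP ->|/eqP ->]; rewrite ?inv; lia.
    have hy' : ((y <= i <= s y) || (s y <= i <= y))%N.
      case/or3P: hy => [|/eqP ->|/eqP ->]; rewrite ?inv; lia.
    rewrite ltnNge leq_eqVlt; apply/norP; split.
      by apply/eqP => /eq_val/perm_inj exy; move: xy; rewrite exy ltnn.
    apply/negP => sxy.
    have c1 := nc _ _ xy.
    have c2 := nc _ _ sxy; rewrite !inv in c2.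
    have e1 : (y = s x :> nat -> s y = x :> nat)%N.
      by move=> /eq_val ->; rewrite inv.
    have e2 : (x = s y :> nat -> s x = y :> nat)%N.
      by move=> /eq_val ->; rewrite inv.
    have [h1|h1] := ltnP y (s x); first exact: c1 h1 sxy.
    have [h2|h2] := ltnP (s y) x; first exact: c2 h2 xy.
    clear c1 c2; lia.
  - case/subsetPn: AE => x xA; have := AC x xA; rewrite inE => /orP[->//|].
    move=> hx _; apply/exists_inP; exists x => //.
    rewrite /arc_min; move: hx; rewrite !inE => /orP[] /eqP ->.
      by rewrite isi.
    by rewrite inv; case: leqP => // h; apply/eqP/eq_val; lia.
  apply/forall_inP => x /AC; rewrite !inE /arc_min => /or3P[|/eqP ->|/eqP ->].
  - by case: (leqP x (s x)) => h1 h2; lia.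
  - by rewrite isi.
  by rewrite inv; case: (leqP (s i) i) => h; lia.
move=> [/decreasing_onP dec /exists_inP[x xA /eqP ex] /forall_inP mx].
have xi : x = i \/ x = s i.
  by move: ex; rewrite /arc_min; case: ifP => _ <-; [left|right; rewrite inv].
split; last first.
  apply/negP => /subsetP/(_ x xA); rewrite inE.
  by case: xi => ->; rewrite ?inv; lia.
apply/subsetP => y yA; rewrite !inE.
have [->|yi] := eqVneq y i; first by rewrite orbT.
have [->|ysi] := eqVneq y (s i); first by rewrite !orbT.
rewrite !orbF.
have syi : s y != i by apply: contra ysi => /eqP <-; rewrite inv.
have := mx y yA.
move: yi syi; rewrite -!val_eqE /= /arc_min => yi syi my.
have d1 := dec _ _ yA xA.
case: (leqP y (s y)) my => h my.
  have [] : (i < s y)%N \/ (s y < i)%N by lia.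
    by lia.
  case: xi => e; rewrite e ?inv in d1; lia.
have [] : (i < y)%N \/ (y < i)%N by lia.
  by lia.
case: xi => e; rewrite e ?inv in d1; lia.
Qed.

(** The decreasing sets with innermost interval at i are the subsets of the
    2h positions strictly over i and the 1 or 2 ends of its interval that are
    not subsets of the former alone; a difference of two binomial coefficients
    then reduces to the stated terms by Pascal's rule. *)
Lemma card_decreasing_on n (s : 'S_n) m :
  involution s -> noncrossing s ->
  #|[set A : {set 'I_n} | decreasing_on s A & #|A| == m.+1]|
  = (\sum_(i < n) (if s i == i then 'C(2 * depth s i, m)
                   else if (i < s i)%N
                   then 'C(2 * depth s i + 1, m) + 'C(2 * depth s i, m)
                   else 0))%N.
Proof.
move=> inv nc; have /involutionP invE := inv.
pose p (A : {set 'I_n}) (i : 'I_n) :=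
  [exists x in A, arc_min s x == i] && [forall x in A, arc_min s x <= i]%N.
transitivity (\sum_(A : {set 'I_n} | decreasing_on s A && (#|A| == m.+1))
                \sum_(i < n) (p A i : nat))%N.
  rewrite -sum1_card (eq_bigl _ _ (fun A => in_set _ A)) /=.
  apply: eq_bigr => A /andP[_ cA].
  have /card_gt0P[x0 x0A] : (0 < #|A|)%N by rewrite (eqP cA).
  pose x := [arg max_(x > x0 in A) arc_min s x].
  have [xA xM] : x \in A /\ forall y, y \in A -> (arc_min s y <= arc_min s x)%N.
    by rewrite /x; case: arg_maxnP.
  have px : p A (arc_min s x).
    apply/andP; split; first by apply/exists_inP; exists x.
    by apply/forall_inP.
  rewrite (bigD1 (arc_min s x)) //= px big1 // => i ne.
  case: (boolP (p A i)) => // /andP[/exists_inP[y yA /eqP ey] /forall_inP mi].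
  case/negP: ne; apply/eqP/val_inj/eqP; rewrite eqn_leq mi // andbT.
  by rewrite -ey xM.
rewrite exchange_big /=; apply: eq_bigr => i _.
have [si|] := leqP i (s i); last first.
  move=> si; have -> : (s i == i) = false.
    by apply/eqP => e; move: si; rewrite e ltnn.
  have -> : (i < s i)%N = false by lia.
  apply: big1 => A _; case: (boolP (p A i)) => //.
  move=> /andP[/exists_inP[y yA /eqP ey] _]; move: ey si; rewrite /arc_min.
  by case: (leqP y (s y)) => h <-; rewrite ?invE; lia.
pose E := strictly_over s i; pose D := E :|: [set i; s i].
have cE : #|E| = (2 * depth s i)%N by apply: card_strictly_over.
transitivity #|[set A : {set 'I_n} | A \subset D & #|A| == m.+1]
               :\: [set A : {set 'I_n} | A \subset E & #|A| == m.+1]|.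
  rewrite -sum1_card -big_mkcondr /=; apply: eq_bigl => A; rewrite !inE.
  have := decreasing_on_innermost A inv nc si; rewrite -/E -/D /p.
  case: (#|A| == _); rewrite ?andbF ?andbT // => <-.
  by rewrite andbC.
rewrite cardsD (_ : _ :&: _ =
  [set A : {set 'I_n} | A \subset E & #|A| == m.+1]); last first.
  apply/setIidPr/subsetP => A; rewrite !inE => /andP[AE ->]; rewrite andbT.
  exact: subset_trans AE (subsetUl _ _).
rewrite !cards_draws cE.
have iE : i \notin E by rewrite inE; lia.
have siE : s i \notin E by rewrite inE invE; lia.
have [e|ne] := eqVneq (s i) i.
  have -> : D = i |: E by rewrite /D e setUid setUC.
  by rewrite cardsU1 iE cE binS addKn.
have lsi : (i < s i)%N.
  by rewrite ltn_neqAle si andbT; apply: contra ne => /eqP/val_inj <-.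
rewrite lsi.
have -> : D = i |: (s i |: E) by rewrite /D setUC setUA.
have iE' : i \notin s i |: E by rewrite in_setU1 negb_or eq_sym ne.
rewrite !cardsU1 iE' siE cE.
rewrite !add1n addn1 !binS; lia.
Qed.

(** * First steps of involutions with open arcs *)

(** The Motzkin paths that start at height h and end at height 0 with m - h
    steps, encoded as paths from height 0 whose first h steps go up. *)
Definition open_involutions h m : {set 'S_m} :=
  [set s : 'S_m | [&& involution s, noncrossing s &
                      [forall i : 'I_m, (i < h)%N ==> (h <= s i)%N]]].

Lemma open_involutionsP h m (s : 'S_m) :
  reflect [/\ forall i, s (s i) = i,
    forall i j : 'I_m, (i < j)%N -> (j < s i)%N -> (s i < s j)%N -> False &
    forall i : 'I_m, (i < h)%N -> (h <= s i)%N] (s \in open_involutions h m).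
Proof.
rewrite inE; apply: (iffP and3P) => -[].
  move=> /involutionP inv /noncrossingP nc /forallP op; split=> // i ih.
  by have /implyP := op i; apply.
move=> inv nc op; split; first exact/involutionP.
  exact/noncrossingP.
by apply/forallP => i; apply/implyP/op.
Qed.

(** The first h positions are not part of the path that starts at height h, so
    they are not counted here. *)
Definition arcs_at h m (s : 'S_m) (x : nat) : nat :=
  \sum_(i < m) ((h <= i < s i) && (depth s i == x))%N.

Definition fixed_at h m (s : 'S_m) (x : nat) : nat :=
  \sum_(i < m) [&& h <= i, s i == i & depth s i == x]%N.

Lemma forall_lift n (h : 'I_n.+1) (P : 'I_n.+1 -> Prop) :
  P h -> (forall i, P (lift h i)) -> forall i, P i.
Proof. by move=> Ph Pl i; case: (unliftP h i) => [j|] ->. Qed.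

Lemma lift_perm_inj n (i j : 'I_n.+1) : injective (lift_perm i j).
Proof.
move=> s t est; apply/permP => x; apply: (@lift_inj _ j).
by rewrite -!(lift_perm_lift i) est.
Qed.

Lemma lift_perm_surj n (i j : 'I_n.+1) (s : 'S_n.+1) :
  s i = j -> exists t, s = lift_perm i j t.
Proof.
move=> sij.
have ne x : j != s (lift i x) by rewrite -sij (inj_eq perm_inj) neq_lift.
pose f x : 'I_n := sval (unlift_some (ne x)).
have fE x : lift j (f x) = s (lift i x).
  by rewrite /f; case: unlift_some.
have f_inj : injective f.
  by move=> x y /(congr1 (lift j)); rewrite !fE => /perm_inj/lift_inj.
exists (perm f_inj); apply/permP; apply: (forall_lift (h := i)).
  by rewrite lift_perm_id.
by move=> x; rewrite lift_perm_lift permE fE.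
Qed.

Lemma card_lift_perm n (i j : 'I_n.+1) (P : pred 'S_n.+1) :
  #|[set s : 'S_n.+1 | (s i == j) && P s]|
  = #|[set t : 'S_n | P (lift_perm i j t)]|.
Proof.
rewrite -(card_imset _ (@lift_perm_inj n i j)); congr #|pred_of_set _|.
apply/setP => s; rewrite inE; apply/andP/imsetP.
  by move=> [/eqP/lift_perm_surj[t ->] Pt]; exists t; rewrite ?inE.
by move=> [t]; rewrite inE => Pt ->; rewrite lift_perm_id.
Qed.

(** Inserting a fixed point after the h open positions adds a level step in
    front of the path. *)
Lemma lift_fixed_open n (h : 'I_n.+1) (t : 'S_n) :
  (lift_perm h h t \in open_involutions h n.+1) = (t \in open_involutions h n).
Proof.
apply/open_involutionsP/open_involutionsP => -[inv nc op]; split.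
- by move=> i; apply: (@lift_inj _ h); rewrite -!(lift_perm_lift h) inv.
- move=> i j ij jti tij; apply: (nc (lift h i) (lift h j));
    by rewrite ?lift_perm_lift /= /bump; lia.
- by move=> i ih; have := op (lift h i); rewrite lift_perm_lift /= /bump; lia.
- apply: (forall_lift (h := h)); first by rewrite !lift_perm_id.
  by move=> i; rewrite !lift_perm_lift inv.
- apply: (forall_lift (h := h)) => [j|i]; first by rewrite lift_perm_id; lia.
  apply: (forall_lift (h := h)).
    by rewrite lift_perm_id lift_perm_lift; lia.
  move=> j; rewrite !lift_perm_lift /= /bump => h1 h2 h3.
  by apply: (nc i j); lia.
apply: (forall_lift (h := h)); first by lia.
by move=> i; have := op i; rewrite lift_perm_lift /= /bump; lia.
Qed.

Lemma depth_lift_fixed n (h : 'I_n.+1) (t : 'S_n) i :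
  depth (lift_perm h h t) (lift h i) = depth t i.
Proof.
rewrite /depth (bigD1_ord h) //= lift_perm_id.
rewrite [X in (nat_of_bool X + _)%N](_ : _ = false); last by lia.
apply: eq_bigr => j _; rewrite lift_perm_lift /= /bump.
by congr nat_of_bool; lia.
Qed.

Lemma arcs_at_lift_fixed n (h : 'I_n.+1) (t : 'S_n) :
  arcs_at h (lift_perm h h t) = arcs_at h t.
Proof.
apply/funext => x.
rewrite /arcs_at (bigD1_ord h) //= lift_perm_id ltnn andbF add0n.
apply: eq_bigr => j _; rewrite depth_lift_fixed lift_perm_lift /= /bump.
by congr (nat_of_bool (_ && _)); lia.
Qed.

(** The arcs over position h are those of the h open positions, as long as
    position h does not close one of them. *)
Lemma depth_at_opening h m (s : 'S_m) (i : 'I_m) :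
  s \in open_involutions h m -> i = h :> nat -> (h <= s i)%N -> depth s i = h.
Proof.
move=> /open_involutionsP [inv nc op] ih hsi.
rewrite /depth; transitivity (\sum_(j < m) (j < h))%N.
  apply: eq_bigr => j _; congr nat_of_bool; rewrite ih.
  have [jh|//] := ltnP j h; rewrite /= ltn_neqAle op // andbT.
  apply/eqP => e; have e' : i = s j by apply: val_inj; rewrite /= ih e.
  by move: hsi; rewrite e' inv; lia.
have hm : (h <= m)%N by rewrite -ih ltnW.
rewrite -(big_mkord xpredT (fun j => (j < h : nat)%N)).
rewrite (big_cat_nat (n := h)) //=.
rewrite (eq_big_nat _ _ (F2 := fun=> 1%N)); last by move=> j /andP[_ ->].
rewrite sum_nat_const_nat subn0 muln1 big_nat big1 ?addn0 // => j.
by move=> /andP[hj _]; rewrite ltnNge hj.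
Qed.

Lemma fixed_at_lift_fixed n (h : 'I_n.+1) (t : 'S_n) :
  t \in open_involutions h n ->
  fixed_at h (lift_perm h h t) = (fun x => fixed_at h t x + (x == h))%N.
Proof.
move=> ht; apply/funext => x; rewrite /fixed_at (bigD1_ord h) //= lift_perm_id.
rewrite leqnn eqxx (@depth_at_opening h) ?lift_perm_id ?lift_fixed_open //.
rewrite addnC eq_sym; congr addn.
apply: eq_bigr => j _; rewrite depth_lift_fixed lift_perm_lift /= /bump.
by rewrite (inj_eq lift_inj); congr (nat_of_bool (_ && _)); lia.
Qed.

(** If position h + 1 closes an arc, then noncrossing forces this arc to start
    at position h, the last one opened.  Inserting such an arc adds a descent in
    front of a path that starts at height h. *)
Section LiftPair.
Variables (n h : nat) (lthn : (h < n.+1)%N).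
Let p : 'I_n.+1 := Ordinal lthn.
Let q0 : 'I_n.+2 := lift ord0 p.
Let q1 : 'I_n.+2 := widen_ord (leqnSn _) p.
Let phi (i : 'I_n) : 'I_n.+2 := lift q0 (lift p i).

Let lift_q0p : lift q0 p = q1.
Proof. by apply: val_inj; rewrite /= /bump /=; lia. Qed.

Let lift_q1p : lift q1 p = q0.
Proof. by apply: val_inj; rewrite /= /bump /=; lia. Qed.

Let phi_q1 i : lift q1 (lift p i) = phi i.
Proof. by apply: val_inj; rewrite /= /bump /=; lia. Qed.

Let val_phi i : phi i = i + 2 * (h <= i) :> nat.
Proof. by rewrite /= /bump /=; lia. Qed.

Definition lift_pair (t : 'S_n) : 'S_n.+2 := lift_perm q0 q1 (lift_perm p p t).

Let lp_q0 t : lift_pair t q0 = q1.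
Proof. exact: lift_perm_id. Qed.

Let lp_q1 t : lift_pair t q1 = q0.
Proof. by rewrite -lift_q0p lift_perm_lift lift_perm_id lift_q1p. Qed.

Let lp_phi t i : lift_pair t (phi i) = phi (t i).
Proof. by rewrite !lift_perm_lift phi_q1. Qed.

Let forall_phi (P : 'I_n.+2 -> Prop) :
  P q0 -> P q1 -> (forall i, P (phi i)) -> forall i, P i.
Proof.
by move=> P0 P1 Pp; apply: (forall_lift (h := q0)) => //;
  apply: (forall_lift (h := p)) => //; rewrite lift_q0p.
Qed.

Let sum_phi (F : 'I_n.+2 -> nat) :
  (\sum_i F i = F q0 + (F q1 + \sum_(i < n) F (phi i)))%N.
Proof. by rewrite (bigD1_ord q0) //= (bigD1_ord p) //= lift_q0p. Qed.

Let phi_inj : injective phi.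
Proof. by move=> i j /lift_inj/lift_inj. Qed.

Let val_q0 : q0 = h.+1 :> nat. Proof. by []. Qed.
Let val_q1 : q1 = h :> nat. Proof. by []. Qed.

Lemma lift_pair_open t :
  (lift_pair t \in open_involutions h.+1 n.+2) = (t \in open_involutions h n).
Proof.
apply/open_involutionsP/open_involutionsP => -[inv nc op]; split.
- by move=> i; apply: phi_inj; rewrite -!lp_phi inv.
- move=> i j ij jti tij; apply: (nc (phi i) (phi j));
    by rewrite ?lp_phi !val_phi; lia.
- by move=> i ih; have := op (phi i); rewrite lp_phi !val_phi; lia.
- apply: forall_phi; rewrite ?lp_q0 ?lp_q1 // => i.
  by rewrite !lp_phi inv.
- apply: forall_phi => [j|j|i].
  + by rewrite lp_q0 val_q0 val_q1; lia.
  + by rewrite lp_q1 val_q0 val_q1; lia.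
  apply: forall_phi => [||j].
  + by rewrite lp_phi lp_q0 !val_phi val_q0 val_q1; lia.
  + by rewrite lp_phi lp_q1 !val_phi val_q0 val_q1; lia.
  by rewrite !lp_phi !val_phi => h1 h2 h3; apply: (nc i j); lia.
apply: forall_phi => [||i].
- by rewrite val_q0; lia.
- by rewrite lp_q1 val_q0; lia.
by have := op i; rewrite lp_phi !val_phi; lia.
Qed.

Lemma depth_lift_pair t i : depth (lift_pair t) (phi i) = depth t i.
Proof.
rewrite /depth sum_phi lp_q0 lp_q1 val_q0 val_q1 val_phi.
rewrite [X in (nat_of_bool X + _)%N](_ : _ = false); last by lia.
rewrite [X in (_ + (nat_of_bool X + _))%N](_ : _ = false); last by lia.
by apply: eq_bigr => j _; rewrite lp_phi !val_phi; congr nat_of_bool; lia.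
Qed.

Lemma arcs_at_lift_pair t : arcs_at h.+1 (lift_pair t) = arcs_at h t.
Proof.
apply/funext => x; rewrite /arcs_at sum_phi lp_q0 lp_q1 val_q0 val_q1 !ltnn /=.
rewrite [X in (nat_of_bool (X && _) + _)%N](_ : _ = false); last by lia.
apply: eq_bigr => j _; rewrite depth_lift_pair lp_phi !val_phi.
by rewrite /bump; congr (nat_of_bool (_ && _)); lia.
Qed.

Lemma fixed_at_lift_pair t : fixed_at h.+1 (lift_pair t) = fixed_at h t.
Proof.
apply/funext => x; rewrite /fixed_at sum_phi lp_q0 lp_q1 -!val_eqE /= ltnn /=.
rewrite [X in (nat_of_bool (_ && (X && _)) + _)%N](_ : _ = false); last first.
  by rewrite /bump; lia.
rewrite andbF; apply: eq_bigr => j _.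
rewrite depth_lift_pair lp_phi (inj_eq phi_inj).
by rewrite /bump; congr (nat_of_bool (_ && _)); lia.
Qed.

Lemma card_closing (P : pred 'S_n.+2) :
  #|[set s in open_involutions h.+1 n.+2 | (s q0 < q0)%N && P s]|
  = #|[set t in open_involutions h n | P (lift_pair t)]|.
Proof.
have -> : [set s in open_involutions h.+1 n.+2 | (s q0 < q0)%N && P s] =
  [set s : 'S_n.+2 |
     (s q0 == q1) && ((s \in open_involutions h.+1 n.+2) && P s)].
  apply/setP => s; rewrite in_set [in RHS]in_set.
  case: (boolP (s \in _)) => hs; last by rewrite andbF.
  rewrite !andTb.
  congr (_ && _).
  move/open_involutionsP: hs => [inv nc op].
  apply/idP/eqP => [lt|->]; last by rewrite val_q0 val_q1.
  apply/val_inj/eqP; rewrite eqn_leq; apply/andP; split; first by rewrite -ltnS.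
  (* otherwise the arcs of [q0] and [q1] cross *)
  rewrite leqNgt; apply/negP => lt1.
  have sq1 : (h.+1 <= s q1)%N by apply: op; rewrite val_q1.
  have sq1' : s q1 != q0 by apply/eqP => e; move: lt1; rewrite -e inv ltnn.
  apply: (nc (s q0) q1); rewrite ?inv // val_q0; last first.
    by rewrite ltn_neqAle sq1 andbT eq_sym.
rewrite card_lift_perm.
transitivity #|[set t : 'S_n.+1 | (t p == p) &&
    ((lift_perm q0 q1 t \in open_involutions h.+1 n.+2)
      && P (lift_perm q0 q1 t))]|.
  congr #|pred_of_set _|; apply/setP => t; rewrite in_set [in RHS]in_set.
  case: (boolP (lift_perm q0 q1 t \in open_involutions h.+1 n.+2)) => /= [ho|];
    last by rewrite andbF.
  suff -> : t p == p by rewrite andTb.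
  move/open_involutionsP: ho => [inv _ _].
  apply/eqP/(@lift_inj _ q1); rewrite -(lift_perm_lift q0) lift_q0p lift_q1p.
  by have := inv q0; rewrite lift_perm_id.
rewrite card_lift_perm; congr #|pred_of_set _|; apply/setP => t.
by rewrite in_set [in RHS]in_set -/(lift_pair t) lift_pair_open.
Qed.

End LiftPair.

(** * Counting involutions by profile *)

Lemma card_set_sum (T : finType) (P : pred T) :
  #|[set x | P x]| = (\sum_x (P x : nat))%N.
Proof.
rewrite -sum1_card big_mkcond /=; apply: eq_bigr => x _.
by rewrite inE; case: (P x).
Qed.

Definition count_open m h (Q : (nat -> nat) -> (nat -> nat) -> Prop) : nat :=
  #|[set s in open_involutions h m | `[< Q (arcs_at h s) (fixed_at h s) >]]|.

Lemma eq_count_open m h Q Q' : (forall u v, Q u v <-> Q' u v) ->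
  count_open m h Q = count_open m h Q'.
Proof.
move=> QQ; congr #|pred_of_set _|; apply/setP => s.
rewrite in_set [in RHS]in_set.
by congr (_ && _); apply: asbool_equiv_eq.
Qed.

Lemma count_open_False m h Q : (forall u v, ~ Q u v) -> count_open m h Q = 0%N.
Proof.
move=> QF; apply/eqP; rewrite cards_eq0; apply/eqP/setP => s.
by rewrite in_set in_set0; apply/negP => /andP[_ /asboolP/QF].
Qed.

(** A first step up does not change the involution: position h merely becomes
    one of the open positions. *)
Lemma opening_open m h (i : 'I_m) (s : 'S_m) : i = h :> nat ->
  (i < s i)%N && (s \in open_involutions h m) = (s \in open_involutions h.+1 m).
Proof.
move=> ih; apply/andP/idP.
  move=> [isi /open_involutionsP [inv nc op]].
  apply/open_involutionsP; split=> // j.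
  rewrite ltnS leq_eqVlt => /orP[/eqP jh|jh].
    by have -> : j = i by [apply: val_inj; rewrite /= jh]; rewrite -ih.
  rewrite ltn_neqAle op // andbT; apply/eqP => e.
  have e' : i = s j by apply: val_inj; rewrite /= ih e.
  by move: isi; rewrite e' inv; lia.
move=> /open_involutionsP [inv nc op]; split; first by rewrite ih op // ih.
apply/open_involutionsP; split=> // j jh; apply: ltnW; apply: op; exact: ltnW.
Qed.

Lemma arcs_at_opening m h (i : 'I_m) (s : 'S_m) : i = h :> nat ->
  s \in open_involutions h.+1 m ->
  arcs_at h s = (fun x => arcs_at h.+1 s x + (x == h))%N.
Proof.
move=> ih hs; apply/funext => x.
move: (hs); rewrite -(opening_open s ih) => /andP[isi ho].
rewrite /arcs_at [LHS](bigD1 i) //= [in RHS](bigD1 i) //= -ih leqnn isi ltnn /=.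
rewrite (depth_at_opening ho) // -?ih; last exact: ltnW.
rewrite add0n addnC eq_sym; congr addn; apply: eq_bigr => j ne.
by congr (nat_of_bool (_ && _)); move: ne; rewrite -val_eqE /=; lia.
Qed.

Lemma fixed_at_opening m h (i : 'I_m) (s : 'S_m) : i = h :> nat ->
  s \in open_involutions h.+1 m -> fixed_at h s = fixed_at h.+1 s.
Proof.
move=> ih hs; apply/funext => x.
move: (hs); rewrite -(opening_open s ih) => /andP[isi ho].
have isi' : (s i == i) = false by apply/eqP => e; move: isi; rewrite e ltnn.
rewrite /fixed_at [LHS](bigD1 i) //= [in RHS](bigD1 i) //=.
rewrite -ih leqnn isi' ltnn /=.
congr addn; apply: eq_bigr => j ne.
by congr (nat_of_bool (_ && _)); move: ne; rewrite -val_eqE /=; lia.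
Qed.

Lemma count_open_split m (i : 'I_m.+1) Q :
  count_open m.+1 i Q =
  (count_open m i (fun u v => Q u (fun x => v x + (x == i))%N) +
   count_open m.+1 i.+1 (fun u v => Q (fun x => u x + (x == i))%N v) +
   #|[set s in open_involutions i m.+1 | (s i < i)%N &&
        `[< Q (arcs_at i s) (fixed_at i s) >] ]|)%N.
Proof.
set B := count_open m.+1 i.+1 _; set A := count_open m i _.
have -> : A = #|[set s : 'S_m.+1 | (s i == i) &&
    ((s \in open_involutions i m.+1)
      && `[< Q (arcs_at i s) (fixed_at i s) >])]|.
  rewrite card_lift_perm; congr #|pred_of_set _|; apply/setP => t.
  rewrite in_set [in RHS]in_set lift_fixed_open.
  case: (boolP (t \in _)) => // ht; rewrite !andTb.
  by rewrite arcs_at_lift_fixed fixed_at_lift_fixed.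
have -> : B = #|[set s : 'S_m.+1 | (i < s i)%N &&
    ((s \in open_involutions i m.+1)
      && `[< Q (arcs_at i s) (fixed_at i s) >])]|.
  congr #|pred_of_set _|; apply/setP => t.
  rewrite in_set [in RHS]in_set andbA opening_open //.
  case: (boolP (t \in _)) => // ht; rewrite !andTb.
  by rewrite (@arcs_at_opening _ i i) // (@fixed_at_opening _ i i).
rewrite /count_open !card_set_sum -!big_split; apply: eq_bigr => s _ /=.
rewrite -(val_eqE (s i)) /=.
by case: (_ \in _); case: asbool; rewrite ?andbF //= ?andbT; case: ltngtP.
Qed.

Lemma count_open_closing m h Q (hm : (h < m.+1)%N) (i : 'I_m.+2) :
  i = h.+1 :> nat ->
  #|[set s in open_involutions h.+1 m.+2 | (s i < i)%N &&
        `[< Q (arcs_at h.+1 s) (fixed_at h.+1 s) >] ]| = count_open m h Q.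
Proof.
move=> ih; have -> : i = lift ord0 (Ordinal hm) by apply: val_inj.
rewrite card_closing; congr #|pred_of_set _|; apply/setP => t.
by rewrite in_set [in RHS]in_set arcs_at_lift_pair fixed_at_lift_pair.
Qed.

(** Steps below height k are left free. *)
Definition has_profile k (d l u v : nat -> nat) : Prop :=
  forall x, (k <= x)%N -> u x = d x /\ v x = l x.

Definition count_profile k n h d l : nat :=
  count_open (h + n) h (has_profile k d l).

Definition decr (f : nat -> nat) (h x : nat) : nat := (f x - (x == h))%N.

(** The three summands are the paths that begin with a level step, with an up
    step and with a descent.  The first two use up one item of the profile, if
    they are taken at height k or more. *)
Lemma count_profileS k n h d l :
  count_profile k n.+1 h d l =
  ((if (h < k)%N then count_profile k n h d l
    else if (0 < l h)%N then count_profile k n h d (decr l h) else 0) +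
   (if (h < k)%N then count_profile k n h.+1 d l
    else if (0 < d h)%N then count_profile k n h.+1 (decr d h) l else 0) +
   (if h is h'.+1 then count_profile k n h' d l else 0))%N.
Proof.
have hm : (h < (h + n).+1)%N by rewrite ltnS leq_addr.
rewrite /count_profile addnS (count_open_split (Ordinal hm)) /=.
congr (_ + _ + _)%N.
- case: ltnP => hk.
    apply: eq_count_open => u v.
    split=> H x kx; have [-> <-] := H x kx; split=> //.
      by rewrite (_ : x == h = false) ?addn0 //; lia.
    by rewrite (_ : x == h = false) ?addn0 //; lia.
  case: ltnP => lh; last first.
    by apply: count_open_False => u v /(_ h hk); rewrite eqxx; lia.
  apply: eq_count_open => u v.
  split=> H x kx; have [-> e] := H x kx; split=> //.
    by rewrite /decr -e addnK.
  by rewrite e /decr subnK //; case: eqP => // ->.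
- case: ltnP => hk.
    apply: eq_count_open => u v.
    split=> H x kx; have [<- ->] := H x kx; split=> //.
      by rewrite (_ : x == h = false) ?addn0 //; lia.
    by rewrite (_ : x == h = false) ?addn0 //; lia.
  case: ltnP => lh; last first.
    by apply: count_open_False => u v /(_ h hk); rewrite eqxx; lia.
  rewrite -[(h + n).+1]addSn.
  apply: eq_count_open => u v.
  split=> H x kx; have [e ->] := H x kx; split=> //.
    by rewrite /decr -e addnK.
  by rewrite e /decr subnK //; case: eqP => // ->.
case: h hm => [|h] hm.
  apply/eqP; rewrite cards_eq0; apply/eqP/setP => s.
  by rewrite in_set in_set0 ltn0 andbF.
have hm' : (h < (h + n).+1)%N by rewrite ltnS leq_addr.
exact: (count_open_closing _ hm').
Qed.

Lemma count_profile0 k h d l :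
  count_profile k 0 h d l =
  ((h == 0%N) && `[< forall x, (k <= x)%N -> d x = 0%N /\ l x = 0%N >] : nat).
Proof.
rewrite /count_profile addn0; case: h => [|h] /=.
  have z (s : 'S_0) : arcs_at 0 s = (fun=> 0%N) /\ fixed_at 0 s = (fun=> 0%N).
    by split; apply/funext => x; rewrite /arcs_at /fixed_at big_ord0.
  have o (s : 'S_0) : s \in open_involutions 0 0.
    by apply/open_involutionsP; split=> -[].
  case: asboolP => H /=.
    transitivity #|[set: 'S_0]|; last by rewrite cardsT card_Sn.
    congr #|pred_of_set _|; apply/setP => s.
    rewrite in_set [in RHS]in_setT o !(z s).1 !(z s).2.
    by apply/asboolP => x /H[-> ->].
  apply/eqP; rewrite cards_eq0; apply/eqP/setP => s; rewrite in_set in_set0.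
  apply/negP => /andP[_ /asboolP]; rewrite !(z s).1 !(z s).2 => H'.
  apply: H => x kx.
  by have [<- <-] := H' x kx.
apply/eqP; rewrite cards_eq0; apply/eqP/setP => s; rewrite in_set in_set0.
apply/negP => /andP[/open_involutionsP[_ _ /(_ ord0 isT)] + _].
by have := ltn_ord (s ord0); lia.
Qed.

(** * From decreasing subsequences to profiles *)

Lemma open_involutions0 n (s : 'S_n) :
  (s \in open_involutions 0 n) = (s \in I3412 n).
Proof.
rewrite in_I3412 inE; case: involution => //=; case: noncrossing => //=.
by apply/forallP.
Qed.

Lemma depth_lt n (s : 'S_n) (i : 'I_n) : (depth s i < n)%N.
Proof.
rewrite /depth (bigD1 i) //= ltnn add0n.
apply: leq_ltn_trans (_ : (\sum_(j < n | j != i) 1 < n)%N).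
  by apply: leq_sum => j _; apply: leq_b1.
rewrite sum1_card cardC1 card_ord; have := ltn_ord i; lia.
Qed.

Lemma sum_by_value n (P : pred 'I_n) (F : 'I_n -> nat) (g : nat -> nat) M :
  (forall i, F i < M)%N ->
  (\sum_(i < n | P i) g (F i)
   = \sum_(0 <= x < M) (\sum_(i < n) (P i && (F i == x))) * g x)%N.
Proof.
move=> FM; under [RHS]eq_bigr do rewrite big_distrl /=.
rewrite exchange_big /= [LHS]big_mkcond /=; apply: eq_bigr => i _.
rewrite big_mkord (bigD1 (Ordinal (FM i))) //= eqxx andbT big1 ?addn0.
  by case: (P i); rewrite ?mul1n.
move=> x ne; rewrite (_ : F i == x = false) ?andbF //.
apply: contraNF ne => /eqP e.
by apply/eqP/val_inj; rewrite /= e.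
Qed.

Definition arc_weight k x := ('C(2 * x + 1, 2 * k) + 'C(2 * x, 2 * k))%N.
Definition fixed_weight k x := 'C(2 * x, 2 * k).

Lemma card_occurrences_by_height n (s : 'S_n) k M :
  s \in I3412 n -> (n <= M)%N ->
  #|occurrences s (decreasing_pattern (2 * k + 1))|
  = (\sum_(0 <= x < M) (arcs_at 0 s x * arc_weight k x
                         + fixed_at 0 s x * fixed_weight k x))%N.
Proof.
rewrite in_I3412 => /andP[inv nc] nM.
rewrite card_occurrences_decreasing addn1 card_decreasing_on // big_split /=.
have dM i : (depth s i < M)%N by apply: leq_trans (depth_lt s i) nM.
rewrite -(sum_by_value (fun i => i < s i)%N (arc_weight k) dM).
rewrite -(sum_by_value (fun i => s i == i) (fixed_weight k) dM).
rewrite [X in (X + _)%N]big_mkcond [X in (_ + X)%N]big_mkcond -big_split /=.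
apply: eq_bigr => i _; case: eqP => [->|_]; first by rewrite ltnn.
by case: ltnP; rewrite ?addn0.
Qed.

(** In [dl_weight] the profile is indexed from height k on, here by the height
    itself. *)
Definition at_height k b (f : 'I_b.+1 -> nat) (x : nat) : nat :=
  if (k <= x <= k + b)%N then f (inord (x - k)) else 0%N.

Lemma at_heightE k b (f : 'I_b.+1 -> nat) (i : 'I_b.+1) :
  at_height k f (k + i) = f i.
Proof.
rewrite /at_height leq_addr leq_add2l -ltnS ltn_ord /=; congr f.
by apply: val_inj; rewrite /= inordK addKn.
Qed.

Lemma at_height_out k b (f : 'I_b.+1 -> nat) x :
  (k + b < x)%N -> at_height k f x = 0%N.
Proof. by rewrite /at_height => h; case: ifP => //; lia. Qed.

Lemma occurrences_of_profile n (s : 'S_n) k b (d l : 'I_b.+1 -> nat) :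
  s \in I3412 n ->
  has_profile k (at_height k d) (at_height k l)
    (arcs_at 0 s) (fixed_at 0 s) ->
  #|occurrences s (decreasing_pattern (2 * k + 1))| = dl_weight k d l.
Proof.
move=> hs prof.
rewrite (@card_occurrences_by_height _ _ k (k + b.+1 + n)) ?leq_addl //.
(* the weights vanish below height k, the profile above height k + b *)
rewrite (big_cat_nat (n := k)) //=; last by lia.
rewrite big_nat big1 ?add0n; last first.
  move=> x /= xk; rewrite /arc_weight /fixed_weight !bin_small ?muln0 //; lia.
rewrite (big_cat_nat (n := k + b.+1)) //=; [|lia|lia].
rewrite [X in (_ + X)%N]big_nat [X in (_ + X)%N]big1 ?addn0; last first.
  move=> x xk; have [|-> ->] := prof x; first by lia.
  by rewrite !at_height_out //; lia.
rewrite -{1}[k]add0n big_addn addKn big_mkord /dl_weight -big_split /=.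
apply: eq_bigr => i _; have [|] := prof (i + k)%N; first by lia.
rewrite addnC !at_heightE => -> ->.
by rewrite /arc_weight /fixed_weight !mulnDr.
Qed.

(** A single step at height k + b + 1 or more already weighs at least
    'C(2k + 2b + 2, 2k). *)
Lemma profile_of_occurrences n (s : 'S_n) k b :
  s \in I3412 n ->
  (#|occurrences s (decreasing_pattern (2 * k + 1))|
     < 'C(2 * k + 2 * b + 2, 2 * k))%N ->
  has_profile k (at_height k (fun i : 'I_b.+1 => arcs_at 0 s (k + i)))
    (at_height k (fun i : 'I_b.+1 => fixed_at 0 s (k + i)))
    (arcs_at 0 s) (fixed_at 0 s).
Proof.
move=> hs lt x kx; have [xb|xb] := leqP x (k + b).
  have hx : (x - k < b.+1)%N by lia.
  have -> : x = (k + Ordinal hx)%N by rewrite /= subnKC.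
  by rewrite !at_heightE.
rewrite !at_height_out //.
have : (arcs_at 0 s x * arc_weight k x + fixed_at 0 s x * fixed_weight k x
  <= #|occurrences s (decreasing_pattern (2 * k + 1))|)%N.
  rewrite (@card_occurrences_by_height _ _ k (n + x.+1)) ?leq_addr //.
  rewrite (bigD1_seq x) ?iota_uniq ?mem_index_iota //=; last by lia.
  exact: leq_addr.
have fw : ('C(2 * k + 2 * b + 2, 2 * k) <= fixed_weight k x)%N.
  by rewrite /fixed_weight leq_bin2l //; lia.
have aw : (fixed_weight k x <= arc_weight k x)%N by rewrite leq_addl.
move: #|occurrences _ _| lt (arcs_at 0 s x) (fixed_at 0 s x).
move=> N lt [|u] [|v] //; rewrite ?mulSn ?mul0n;
  do ?[move: (u * _)%N => uw]; do ?[move: (v * _)%N => vw]; lia.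
Qed.

Lemma I3412_count_by_profile r k b n :
  (r < 'C(2 * k + 2 * b + 2, 2 * k))%N ->
  I3412_count (2 * k + 1) r n =
  (\sum_(d : {ffun 'I_b.+1 -> 'I_r.+1})
    \sum_(l : {ffun 'I_b.+1 -> 'I_r.+1} |
            r == dl_weight k (fun i => d i : nat) (fun i => l i : nat))
      count_profile k n 0 (at_height k (fun i => d i : nat))
        (at_height k (fun i => l i : nat)))%N.
Proof.
move=> rb.
under eq_bigr => d _ do (under eq_bigr => l _ do
  rewrite /count_profile /count_open card_set_sum).
rewrite /I3412_count card_set_sum.
under [RHS]eq_bigr => d _ do rewrite exchange_big /=.
rewrite exchange_big /=; apply: eq_bigr => s _.
rewrite open_involutions0.
case: (boolP (s \in I3412 n)) => [hs|_] /=; last first.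
  by rewrite big1 // => d _; rewrite big1.
case: eqP => [e|ne] /=; last first.
  rewrite big1 // => d _; rewrite big1 // => l /eqP rw.
  case: asboolP => // /(occurrences_of_profile hs) e.
  by case: ne; rewrite e.
have prof : has_profile k (at_height k (fun i : 'I_b.+1 => arcs_at 0 s (k + i)))
    (at_height k (fun i : 'I_b.+1 => fixed_at 0 s (k + i)))
    (arcs_at 0 s) (fixed_at 0 s).
  by apply: profile_of_occurrences => //; rewrite e.
have rw := occurrences_of_profile hs prof; rewrite e in rw.
have bd i := andP (dl_weight_bound k (fun i : 'I_b.+1 => arcs_at 0 s (k + i))
   (fun i : 'I_b.+1 => fixed_at 0 s (k + i)) i).
rewrite -rw in bd.
pose d0 := [ffun i : 'I_b.+1 => inord (arcs_at 0 s (k + i)) : 'I_r.+1].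
pose l0 := [ffun i : 'I_b.+1 => inord (fixed_at 0 s (k + i)) : 'I_r.+1].
have d0E : (fun i => d0 i : nat) = (fun i => arcs_at 0 s (k + i)).
  by apply/funext => i; rewrite ffunE inordK // ltnS; case: (bd i).
have l0E : (fun i => l0 i : nat) = (fun i => fixed_at 0 s (k + i)).
  by apply/funext => i; rewrite ffunE inordK // ltnS; case: (bd i).
have uniq (d l : {ffun 'I_b.+1 -> 'I_r.+1}) :
    has_profile k (at_height k (fun i => d i : nat))
      (at_height k (fun i => l i : nat)) (arcs_at 0 s) (fixed_at 0 s) ->
    d = d0 /\ l = l0.
  move=> H; split; apply/ffunP => i; apply: val_inj; rewrite /= ffunE;
    have [|e1 e2] := H (k + i)%N; rewrite ?leq_addr //.
    by rewrite inordK ?e1 ?at_heightE // ltnS.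
  by rewrite inordK ?e2 ?at_heightE // ltnS.
rewrite (bigD1 d0) //= (bigD1 l0) /=; last by rewrite d0E l0E -rw.
rewrite d0E l0E asboolT // big1 ?big1 //.
  move=> d /eqP ne; apply: big1 => l _; case: asboolP => // /uniq[e0 _].
  by case: ne.
move=> l /andP[_ /eqP ne]; case: asboolP => //; rewrite -d0E => /uniq[_ e0].
by case: ne.
Qed.

(** * The number of arrangements of a profile *)

(** The number of words with d letters of one kind, l letters of a second kind
    and c - 1 separators, that is, of sequences of d arcs and l fixed points
    distributed over c boxes.  For c = 0 it is 1 if there is nothing to
    distribute and 0 otherwise. *)
Definition arrangements (d l c : nat) : nat :=
  ('C(d + l + c - 1, d + l) * 'C(d + l, l))%N.


Local Arguments binomial : simpl never.
(** Pascal's rule by the first letter of the word: in the last summand it is a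
    separator.  If c = 0 and d = l = 0, the word is empty, and the last summand
    accounts for it. *)
Lemma arrangementsS d l c :
  arrangements d l c.+1 =
  ((if (0 < l)%N then arrangements d l.-1 c.+1 else 0) +
   (if (0 < d)%N then arrangements d.-1 l c.+1 else 0) + arrangements d l c)%N.
Proof.
have E d' l' :
    arrangements d' l' c.+1 = ('C(d' + l' + c, d' + l') * 'C(d' + l', l'))%N.
  by rewrite /arrangements addnS subn1.
rewrite !E; case: d l => [|d] [|l] //=.
- by rewrite /arrangements !addn0 !bin0.
- by rewrite /arrangements !add0n !binn !muln1 addn0 !addSn subn1 binS addnC.
- by rewrite /arrangements !addn0 !bin0 !muln1 add0n !addSn subn1 binS addnC.
rewrite /arrangements !addSn !addnS !addSn subn1 /=.
rewrite ?succnK (binS (d + l + c).+1) (binS (d + l).+1) !mulnDl !mulnDr.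
lia.
Qed.

Lemma arrangements_no_box d l : (0 < d + l)%N -> arrangements d l 0 = 0%N.
Proof. by move=> dl; rewrite /arrangements bin_small // addn0; lia. Qed.

(** The number of visits at height x whose steps are separated from one another:
    one for each arc that leads up to x, and one more if the path starts at x or
    higher.  At height k the steps form a single sequence, since the excursions
    below k are counted separately. *)
Definition boxes k h (d : nat -> nat) x : nat :=
  if (x == k)%N then 1%N else (d x.-1 + (x <= h))%N.

Definition profile_coef k K h (d l : nat -> nat) : nat :=
  (\prod_(k <= x < K) arrangements (d x) (l x) (boxes k h d x))%N.

Definition profile_size k K (d l : nat -> nat) : nat :=
  (\sum_(k <= x < K) (2 * d x + l x))%N.

Lemma decr_same f h : decr f h h = (f h).-1.
Proof. by rewrite /decr eqxx subn1. Qed.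

Lemma decr_other f h x : x != h -> decr f h x = f x.
Proof. by rewrite /decr => /negPf ->; rewrite subn0. Qed.

(** The first step of a path that starts at height h concerns only the factor
    of height h, and Pascal's rule for this factor gives the three terms: an up
    step moves the start to h + 1, where the arc that is removed at height h
    makes up for the additional box, and a descent takes one box away from
    height h.  At height k there is no descent inside the profile; the only
    arrangement whose factor at k does not begin with a step is the one without
    steps at k. *)
Lemma profile_coef_step k K h d l : (k <= h < K)%N ->
  profile_coef k K h d l =
  ((if (0 < l h)%N then profile_coef k K h d (decr l h) else 0) +
   (if (0 < d h)%N then profile_coef k K h.+1 (decr d h) l else 0) +
   (if h == k then
      if (d k + l k == 0)%N then profile_coef k K h d l else 0
    else profile_coef k K h.-1 d l))%N.
Proof.
move=> hK; pose c := if h == k then 0%N else d h.-1.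
pose rest :=
  (\prod_(k <= x < K | x != h) arrangements (d x) (l x) (boxes k h d x))%N.
have split h' d' l' : (forall x, (k <= x < K)%N -> x != h ->
     arrangements (d' x) (l' x) (boxes k h' d' x) =
     arrangements (d x) (l x) (boxes k h d x)) ->
   profile_coef k K h' d' l'
   = (arrangements (d' h) (l' h) (boxes k h' d' h) * rest)%N.
  move=> H; rewrite /profile_coef (bigD1_seq h) ?iota_uniq ?mem_index_iota //=.
  congr (_ * _)%N; rewrite big_nat_cond [RHS]big_nat_cond.
  by apply: eq_bigr => x /andP[]; apply: H.
have bc : boxes k h d h = c.+1.
  by rewrite /boxes /c; case: eqP => // _; rewrite leqnn addn1.
have e1 : (0 < l h)%N ->
    profile_coef k K h d (decr l h)
    = (arrangements (d h) (l h).-1 c.+1 * rest)%N.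
  move=> _; rewrite (split h d (decr l h)) ?bc ?decr_same //.
  by move=> x _ xh; rewrite decr_other.
have e2 : (0 < d h)%N ->
    profile_coef k K h.+1 (decr d h) l
    = (arrangements (d h).-1 (l h) c.+1 * rest)%N.
  move=> dh; rewrite (split h.+1 (decr d h) l).
    rewrite decr_same; congr (arrangements _ _ _ * _)%N; rewrite -bc /boxes.
    by case: eqP => // hk; rewrite decr_other; lia.
  move=> x xK xh; rewrite decr_other //; congr arrangements; rewrite /boxes.
  case: eqP => // xk; have [e|ne] := eqVneq x h.+1.
    by rewrite e /= decr_same; lia.
  by rewrite decr_other; lia.
have e3 : (h != k)%N ->
    profile_coef k K h.-1 d l = (arrangements (d h) (l h) c * rest)%N.
  move=> hk; rewrite (split h.-1 d l).
    by congr (arrangements _ _ _ * _)%N; rewrite /boxes /c (negPf hk); lia.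
  move=> x xK xh; congr arrangements; rewrite /boxes; case: eqP => // xk; lia.
rewrite [LHS](split h d l) // bc arrangementsS !mulnDl; congr (_ + _ + _)%N.
- by case: ifP => // /e1.
- by case: ifP => // /e2.
case: eqP => [hk|/eqP/e3//]; case: eqP => [e|ne].
  rewrite (split h d l) // bc /c hk eqxx.
  by have [-> ->] : d k = 0%N /\ l k = 0%N by lia.
by rewrite /c hk eqxx arrangements_no_box //; lia.
Qed.

(** Without steps at height k there is no box at height k + 1, hence no step
    there if the coefficient is not 0, and so on upwards. *)
Lemma profile_coef_stuck k K d l :
  (forall x, (K <= x)%N -> d x = 0%N /\ l x = 0%N) -> (d k + l k = 0)%N ->
  profile_coef k K k d l
  = `[< forall x, (k <= x)%N -> d x = 0%N /\ l x = 0%N >] :> nat.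
Proof.
move=> supp e; case: asboolP => [z|nz].
  rewrite /profile_coef big_nat big1 // => x /andP[/z[-> ->] _].
  by rewrite /arrangements !addn0 !bin0.
apply/eqP; apply: contra_notT nz; rewrite -lt0n => pos x kx.
suff z : forall i, (d (k + i) + l (k + i) = 0)%N.
  by have := z (x - k)%N; rewrite subnKC //; lia.
elim=> [|i IH]; first by rewrite addn0.
have [xK|Kx] := ltnP (k + i.+1) K; last by have [-> ->] := supp _ Kx.
move: pos; rewrite /profile_coef.
rewrite (bigD1_seq (k + i.+1)%N) ?iota_uniq ?mem_index_iota //=; last first.
  by rewrite xK andbT leq_addr.
rewrite muln_gt0 => /andP[+ _].
have -> : boxes k k d (k + i.+1) = 0%N.
  rewrite /boxes addnS /=; have -> : ((k + i).+1 == k) = false by lia.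
  by have -> : ((k + i).+1 <= k)%N = false; lia.
by case: (posnP (d (k + i.+1) + l (k + i.+1))%N) => // /arrangements_no_box ->.
Qed.
(** * Formal power series as a module over polynomials *)

Local Open Scope ring_scope.

(** Polynomials act on formal power series by multiplication.  This module
    structure is all that is needed to solve linear systems between generating
    functions and to express [is_power_series]. *)
Definition series (R : nzRingType) := nat -> R.
HB.instance Definition _ (R : nzRingType) :=
  GRing.Zmodule.copy (series R) (nat -> R).

Section Series.
Variable R : nzRingType.
Implicit Types (p q : {poly R}) (a b : series R).

Definition poly_act p a : series R := fun n => \sum_(i < n.+1) p`_i * a (n - i)%N.

(** Each coefficient of a product depends only on a truncation of the series,
    and for truncations the product is that of polynomials. *)
Lemma poly_actE p a n m :
  (n < m)%N -> poly_act p a n = (p * \poly_(i < m) a i)`_n.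
Proof.
move=> nm; rewrite coefM; apply: eq_bigr => i _; rewrite coef_poly ifT //.
exact: leq_ltn_trans (leq_subr _ _) nm.
Qed.

Lemma poly_actA p q a : poly_act p (poly_act q a) = poly_act (p * q) a.
Proof.
apply/funext => n; rewrite (@poly_actE (p * q) a n n.+1) // -mulrA coefM.
apply: eq_bigr => i _; rewrite (@poly_actE q a _ n.+1) // ltnS; exact: leq_subr.
Qed.

Lemma poly_act1 a : poly_act 1 a = a.
Proof.
apply/funext => n.
rewrite /poly_act big_ord_recl coef1 mul1r subn0 big1 ?addr0 //.
by move=> i _; rewrite coef1 mul0r.
Qed.

Lemma poly_actDr p : {morph poly_act p : a b / a + b}.
Proof.
move=> a b; apply/funext => n; rewrite /poly_act -[RHS]big_split /=.
by apply: eq_bigr => i _; rewrite -mulrDr.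
Qed.

Lemma poly_actDl a : {morph poly_act^~ a : p q / p + q}.
Proof.
move=> p q; apply/funext => n; rewrite /poly_act -[RHS]big_split /=.
by apply: eq_bigr => i _; rewrite coefD -mulrDl.
Qed.

HB.instance Definition _ := GRing.Zmodule_isLmodule.Build {poly R} (series R)
  poly_actA poly_act1 poly_actDr poly_actDl.

Definition one_series : series R := fun n => (n == 0%N)%:R.

Lemma scale_one_series p n : (p *: one_series) n = p`_n.
Proof.
rewrite /GRing.scale /= /poly_act big_ord_recr /= subnn /one_series eqxx mulr1.
rewrite big1 ?add0r // => i _; rewrite subn_eq0 leqNgt ltn_ord mulr0 //.
Qed.

Lemma scaleX_series a n : ('X *: a) n = if n is n'.+1 then a n' else 0.
Proof.
rewrite /GRing.scale /= /poly_act; case: n => [|n].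
  by rewrite big_ord1 coefX mul0r.
rewrite big_ord_recl coefX mul0r add0r big_ord_recl coefX mul1r subSS subn0.
by rewrite big1 ?addr0 // => i _; rewrite coefX mul0r.
Qed.

End Series.

(** * Generating functions of the profiles *)

Lemma profile_size_fixed k K d l h : (k <= h < K)%N -> (0 < l h)%N ->
  profile_size k K d l = (profile_size k K d (decr l h)).+1.
Proof.
move=> hK lh; rewrite /profile_size (bigD1_seq h) ?iota_uniq ?mem_index_iota //=.
rewrite [in RHS](bigD1_seq h) ?iota_uniq ?mem_index_iota //= decr_same.
rewrite [in RHS](eq_bigr (fun x => 2 * d x + l x)%N); last first.
  by move=> x xh; rewrite decr_other.
lia.
Qed.

Lemma profile_size_arc k K d l h : (k <= h < K)%N -> (0 < d h)%N ->
  profile_size k K d l = (profile_size k K (decr d h) l).+2.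
Proof.
move=> hK lh; rewrite /profile_size (bigD1_seq h) ?iota_uniq ?mem_index_iota //=.
rewrite [in RHS](bigD1_seq h) ?iota_uniq ?mem_index_iota //= decr_same.
rewrite [in RHS](eq_bigr (fun x => 2 * d x + l x)%N); last first.
  by move=> x xh; rewrite decr_other.
lia.
Qed.

Section GeneratingFunctions.
Variable R : comNzRingType.

Definition profile_series k h d l : series R :=
  fun n => (count_profile k n h d l)%:R.

(** The determinant of 1 - X M, where M is the transfer matrix of the steps
    inside a strip of j consecutive heights. *)
Fixpoint strip_poly j : {poly R} :=
  match j with
  | 0 => 1
  | j'.+1 => match j' with
             | 0 => 1 - 'X
             | i.+1 => (1 - 'X) * strip_poly j' - 'X^2 * strip_poly i
             end
  end.

Lemma strip_polySS j :
  strip_poly j.+2 = (1 - 'X) * strip_poly j.+1 - 'X^2 * strip_poly j.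
Proof. by []. Qed.

(** The same determinant for the k + 1 heights from 0 to k with no level step at
    height k, see [strip_denS]. *)
Definition strip_den k : {poly R} := strip_poly k.+1 + 'X * strip_poly k.

Lemma strip_denS k : strip_den k.+1 = strip_poly k.+1 - 'X^2 * strip_poly k.
Proof. by rewrite /strip_den strip_polySS; ring. Qed.

Variable k : nat.
Hypothesis k_gt0 : (0 < k)%N.

Definition zero_profile (d l : nat -> nat) : bool :=
  `[< forall x, (k <= x)%N -> d x = 0%N /\ l x = 0%N >].

Notation gf := (profile_series k).
Notation one := (one_series R).

Lemma profile_series0 d l :
  gf 0 d l = (zero_profile d l)%:R *: one + 'X *: (gf 0 d l + gf 1 d l).
Proof.
apply/funext => n.
rewrite -[RHS]/(((zero_profile d l)%:R *: one) n
                + ('X *: (gf 0 d l + gf 1 d l)) n).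
rewrite scaleX_series scale_one_series /profile_series coefMn coef1.
case: n => [|n]; first by rewrite count_profile0 /= addr0.
by rewrite mul0rn add0r count_profileS k_gt0 addn0 natrD.
Qed.

Lemma profile_series_low h d l : (h.+1 < k)%N ->
  gf h.+1 d l = 'X *: (gf h.+1 d l + gf h.+2 d l + gf h d l).
Proof.
move=> hk; apply/funext => n; rewrite scaleX_series /profile_series.
case: n => [|n]; first by rewrite count_profile0.
by rewrite count_profileS hk !natrD.
Qed.

Definition after_fixed h d l : series R :=
  if (0 < l h)%N then gf h d (decr l h) else 0.
Definition after_arc h d l : series R :=
  if (0 < d h)%N then gf h.+1 (decr d h) l else 0.

Lemma profile_series_high h d l : (k <= h.+1)%N ->
  gf h.+1 d l = 'X *: (after_fixed h.+1 d l + after_arc h.+1 d l + gf h d l).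
Proof.
move=> hk; apply/funext => n; rewrite scaleX_series /profile_series.
case: n => [|n]; first by rewrite count_profile0.
rewrite count_profileS ltnNge hk /= !natrD.
by congr (_ + _ + _); rewrite ?/after_fixed ?/after_arc; case: ifP.
Qed.

Lemma low_eq0 d l :
  (1 - 'X) *: gf 0 d l = 'X *: gf 1 d l + (zero_profile d l)%:R *: one.
Proof.
rewrite scalerBl scale1r {1}profile_series0 scalerDr.
by rewrite -addrA [X in _ + X]addrAC subrr add0r addrC.
Qed.

Lemma low_eqS h d l : (h.+1 < k)%N ->
  (1 - 'X) *: gf h.+1 d l = 'X *: gf h.+2 d l + 'X *: gf h d l.
Proof.
move=> hk; rewrite scalerBl scale1r {1}profile_series_low // !scalerDr.
by rewrite addrAC [X in X + _]addrAC subrr add0r.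
Qed.

(** Gaussian elimination from height 0 upwards expresses the series at height h
    by the one at height h + 1. *)
Lemma strip_elimination h d l : (h < k)%N ->
  strip_poly h.+1 *: gf h d l =
  ('X * strip_poly h) *: gf h.+1 d l + ('X^h * (zero_profile d l)%:R) *: one.
Proof.
elim: h => [|h IH] hk; first by rewrite low_eq0 mulr1 mul1r.
rewrite strip_polySS scalerBl [(1 - _) * _]mulrC -[(_ * (1 - _)) *: _]scalerA.
rewrite low_eqS // scalerDr !scalerA.
rewrite ![strip_poly h.+1 * 'X]mulrC.
rewrite -[('X * strip_poly h.+1) *: gf h d l]scalerA IH ?(ltnW hk) //.
rewrite scalerDr !scalerA.
rewrite -addrA; congr (_ + _).
have -> : 'X^2 * strip_poly h = 'X * ('X * strip_poly h) by ring.
by rewrite addrC addrA addNr add0r exprS mulrA.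
Qed.

(** At height k the same elimination leaves only the terms in which the profile
    has decreased. *)
Lemma strip_elimination_top h d l : h.+1 = k ->
  strip_den h.+1 *: gf h.+1 d l =
  ('X * strip_poly h.+1) *: (after_fixed h.+1 d l + after_arc h.+1 d l)
  + ('X^(h.+1) * (zero_profile d l)%:R) *: one.
Proof.
move=> hk; have [kh hk'] : (k <= h.+1)%N /\ (h < k)%N by rewrite -hk.
rewrite strip_denS scalerBl {1}profile_series_high //.
move: (after_fixed _ _ _ + _) => A.
rewrite scalerA [strip_poly h.+1 * 'X]mulrC scalerDr.
rewrite -[('X * _) *: gf h d l]scalerA.
rewrite strip_elimination // scalerDr !scalerA -addrA; congr (_ + _).
have -> : 'X^2 * strip_poly h = 'X * ('X * strip_poly h) by ring.
by rewrite addrC addrA addNr add0r exprS mulrA.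
Qed.

(** Elimination in the other direction, which relates height 0 to height h
    without a division. *)
Lemma strip_base h d l : (h <= k)%N -> ~~ zero_profile d l ->
  strip_poly h *: gf 0 d l = 'X^h *: gf h d l.
Proof.
move=> hk nz.
have E0 : (1 - 'X) *: gf 0 d l = 'X *: gf 1 d l.
  by rewrite low_eq0 (negPf nz) scale0r addr0.
suff H i : (i < k)%N -> strip_poly i *: gf 0 d l = 'X^i *: gf i d l /\
    strip_poly i.+1 *: gf 0 d l = 'X^(i.+1) *: gf i.+1 d l.
  by case: h hk => [|h] hk; [have [] := H 0%N k_gt0 | have [] := H h hk].
elim: i => [|i IH] ik; first by rewrite expr0 expr1 !scale1r.
have [|IH1 IH2] := IH; first exact: ltnW.
split=> //; rewrite strip_polySS scalerBl -!scalerA IH1 IH2 !scalerA.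
rewrite [(1 - 'X) * _]mulrC -[(_ * (1 - 'X)) *: _]scalerA.
rewrite low_eqS // scalerDr !scalerA.
have -> : 'X^(i.+1) * 'X = 'X^(i.+2) :> {poly R} by rewrite -exprSr.
have -> : 'X^2 * 'X^i = 'X^(i.+2) :> {poly R} by rewrite -exprD.
by rewrite addrK.
Qed.

End GeneratingFunctions.

Section ProfileFormula.
Variables (R : comNzRingType) (k : nat).
Hypothesis k_gt0 : (0 < k)%N.
Notation gf := (profile_series R k).
Notation one := (one_series R).
Notation P := (strip_poly R k).
Notation D := (strip_den R k).
Notation size K d l := (profile_size k K d l).

(** By induction on the size of the profile, then on the height of the start:
    every step except a descent shrinks the profile, and descents lead down to
    height k, where [strip_elimination_top] applies.  There a factor
    [strip_poly] and the inverse of a factor [strip_den] appear for each of the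
    steps at height k, and a further [strip_den] for the last excursion. *)
Lemma profile_series_formula K d l h :
  (forall x, (K <= x.+1)%N -> d x = 0%N /\ l x = 0%N) -> (k <= h < K)%N ->
  D ^+ (d k + l k).+1 *: gf h d l =
  ((profile_coef k K h d l)%:R * 'X^(size K d l + h) * P ^+ (d k + l k)) *: one.
Proof.
have [W sW] := ubnP (size K d l); elim: W h d l sW => // W IHW h d l sW supp.
case/andP => kh hK.
(* the number of steps left at height k after such a step at height h *)
pose N h := (d k + l k - (h == k))%N.
(* contributions of the paths that begin with a level or an up step *)
have fixedE h' : (k <= h' < K)%N ->
    D ^+ (N h').+1 *: ('X *: after_fixed R k h' d l) =
    ((if (0 < l h')%N then profile_coef k K h' d (decr l h') else 0%N)%:R
     * 'X^(size K d l + h') * P ^+ N h') *: one.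
  move=> h'K; rewrite /after_fixed; case: ltnP => lh; last first.
    by rewrite !scaler0 !mul0r scale0r.
  have e : (d k + decr l h' k = N h')%N.
    by rewrite /N /decr eq_sym; case: eqP lh => [->|]; lia.
  have sE := profile_size_fixed d h'K lh.
  rewrite scalerA [_ * 'X]mulrC -[('X * _) *: _]scalerA -e IHW //; last first.
  - by move=> x /supp[-> lx]; rewrite /decr lx.
  - by rewrite -ltnS -sE.
  by rewrite scalerA sE addSn exprS; congr (_ *: _); ring.
have arcE h' : (k <= h' < K)%N ->
    D ^+ (N h').+1 *: ('X *: after_arc R k h' d l) =
    ((if (0 < d h')%N then profile_coef k K h'.+1 (decr d h') l else 0%N)%:R
     * 'X^(size K d l + h') * P ^+ N h') *: one.
  move=> h'K; rewrite /after_arc; case: ltnP => dh; last first.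
    by rewrite !scaler0 !mul0r scale0r.
  have e : (decr d h' k + l k = N h')%N.
    by rewrite /N /decr eq_sym; case: eqP dh => [->|]; lia.
  have sE := profile_size_arc l h'K dh.
  rewrite scalerA [_ * 'X]mulrC -[('X * _) *: _]scalerA -e IHW //; last first.
  - rewrite (leq_trans _ (leqnSn _)) ?(andP h'K).1 //= ltnNge; apply/negP.
    by move=> /supp[d0]; rewrite d0 in dh.
  - by move=> x /supp[dx ->]; rewrite /decr dx.
  - by move: sW; rewrite sE; lia.
  by rewrite scalerA sE addSnnS !addSn exprS; congr (_ *: _); ring.
elim: h kh hK => [|h IHh] kh hK.
  by move: k_gt0 kh; case: k.
have hKb : (k <= h.+1 < K)%N by rewrite kh hK.
have {}fixedE := fixedE _ hKb; have {}arcE := arcE _ hKb.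
have [hk|hk] := eqVneq h.+1 k; last first.
  have NE : N h.+1 = (d k + l k)%N by rewrite /N (negPf hk) subn0.
  rewrite NE in fixedE arcE.
  rewrite profile_coef_step // (negPf hk) /= profile_series_high // !scalerDr.
  rewrite fixedE arcE scalerA [_ * 'X]mulrC -[('X * _) *: _]scalerA.
  rewrite IHh; last 2 first.
  - by rewrite -ltnS ltn_neqAle eq_sym hk.
  - exact: ltnW.
  rewrite scalerA -!scalerDl; congr (_ *: _).
  by rewrite !natrD addnS exprS; ring.
have top := strip_elimination_top R k_gt0 d l hk.
rewrite {}hk in fixedE arcE kh hK hKb top *.
have [z|nz] := posnP (d k + l k)%N.
  rewrite z !expr0 expr1 top mulr1.
  have -> : after_fixed R k k d l = 0.
    by rewrite /after_fixed; case: ltnP => //; lia.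
  have -> : after_arc R k k d l = 0.
    by rewrite /after_arc; case: ltnP => //; lia.
  rewrite addr0 scaler0 add0r profile_coef_stuck //; last first.
    by move=> x Kx; apply: supp; apply: leqW.
  rewrite -/(zero_profile k d l).
  case: (boolP (zero_profile k d l)) => [/asboolP zp|_].
    rewrite /profile_size big_nat big1 ?add0n; last first.
      by move=> x /andP[/zp[-> ->]].
    by rewrite mulrC.
  by rewrite mulr0 mul0r.
have nzp : zero_profile k d l = false.
  by apply/negbTE; apply/asboolP => /(_ k (leqnn k)); lia.
have NE : (N k).+1 = (d k + l k)%N by rewrite /N eqxx; lia.
rewrite nzp mulr0 scale0r addr0 in top.
rewrite profile_coef_step // eqxx (gtn_eqF nz) addn0 exprSr -scalerA top.
have rot p q r (v : series R) : p *: ((q * r) *: v) = r *: (p *: (q *: v)).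
  by rewrite !scalerA; congr (_ *: _); ring.
rewrite rot !scalerDr -NE fixedE arcE !scalerA -!scalerDl; congr (_ *: _).
by rewrite !natrD exprS; ring.
Qed.

End ProfileFormula.

Lemma profile_series_from0 (R : comNzRingType) k K d l :
  (0 < k)%N -> (k < K)%N ->
  (forall x, (K <= x.+1)%N -> d x = 0%N /\ l x = 0%N) ->
  ~~ zero_profile k d l ->
  (strip_poly R k * strip_den R k ^+ (d k + l k).+1)
    *: profile_series R k 0 d l =
  ((profile_coef k K k d l)%:R * 'X^(profile_size k K d l + 2 * k)
    * strip_poly R k ^+ (d k + l k)) *: one_series R.
Proof.
move=> k0 kK supp nz.
rewrite [strip_poly R k * _]mulrC -[(_ * strip_poly R k) *: _]scalerA.
rewrite strip_base // scalerA [_ * 'X^k]mulrC -['X^k * _ *: _]scalerA.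
rewrite (profile_series_formula R k0 supp) ?leqnn // scalerA; congr (_ *: _).
by rewrite mul2n -addnn addnA [in RHS]exprD; ring.
Qed.

Section PowerSeries.
Variable R : fieldType.
Notation ps := (@is_power_series R).

Lemma is_power_seriesP (a : series R) f :
  ps a f <-> exists p q : {poly R},
    [/\ q != 0, f = tofrac p / tofrac q & q *: a = p *: one_series R].
Proof.
split=> -[p [q [q0 fE H]]]; exists p, q; split=> //.
  by apply/funext => n; rewrite scale_one_series; apply: H.
by move=> n; rewrite -(scale_one_series p) -H.
Qed.

Lemma is_power_series0 : ps (fun=> 0) 0.
Proof.
apply/is_power_seriesP; exists 0, 1; split; rewrite ?oner_neq0 ?rmorph0 ?mul0r //.
by rewrite scale1r scale0r.
Qed.

Lemma is_power_seriesD a b f g : ps a f -> ps b g ->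
  ps (fun n => a n + b n) (f + g).
Proof.
move=> /is_power_seriesP[p [q [q0 -> Ha]]].
move=> /is_power_seriesP[p' [q' [q0' -> Hb]]].
apply/is_power_seriesP; exists (p * q' + p' * q), (q * q'); split.
- by rewrite mulf_neq0.
- by rewrite addf_div ?tofrac_eq0 // !rmorphM rmorphD !rmorphM.
rewrite -[fun n => _]/((a : series R) + b) scalerDr scalerDl.
congr (_ + _); last by rewrite -[(q * q') *: _]scalerA Hb scalerA [p' * q]mulrC.
by rewrite [q * q']mulrC -[(q' * q) *: _]scalerA Ha scalerA [p * q']mulrC.
Qed.

Lemma is_power_series_sum (I : Type) (r : seq I) (Q : pred I)
    (a : I -> nat -> R) f :
  (forall i, Q i -> ps (a i) (f i)) ->
  ps (fun n => \sum_(i <- r | Q i) a i n) (\sum_(i <- r | Q i) f i).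
Proof.
move=> H; elim: r => [|i r IH].
  rewrite big_nil (_ : (fun n => _) = (fun=> 0)); first exact: is_power_series0.
  by apply/funext => n; rewrite big_nil.
rewrite big_cons (_ : (fun n => _) = (fun n => (if Q i then a i n else 0)
    + \sum_(i <- r | Q i) a i n)); last first.
  by apply/funext => n; rewrite big_cons; case: ifP; rewrite ?add0r.
case: ifP => Qi; first by apply: is_power_seriesD => //; apply: H.
rewrite (_ : (fun n => _) = fun n => \sum_(i <- r | Q i) a i n) //.
by apply/funext => n; rewrite add0r.
Qed.

End PowerSeries.

Lemma strip_step (F : fieldType) (x A B : F) j : x != 0 ->
  (1 - x) * (x ^+ j.+1 * B) - x ^+ 2 * (x ^+ j * A)
  = x ^+ j.+2 * ((1 - x) / x * B - A).
Proof. by move=> x0; rewrite !exprS expr0; move: (x ^+ j) => X; field. Qed.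

Section Chebyshev.
Variable R : realType.

(** The cosines include infinitely many numbers, for instance all 1 / (i + 2),
    so a polynomial that vanishes on them is 0; this identifies the polynomial
    picked in [chebyshevU]. *)
Lemma poly_cos_eq0 (p : {poly R}) :
  (forall t : R, sin t != 0 -> p.[cos t] = 0) -> p = 0.
Proof.
move=> H; apply: contraTeq isT => p0.
pose rs := [seq (i.+2%:R : R)^-1 | i <- iota 0 (size p)].
have := @max_poly_roots _ p rs p0; rewrite size_map size_iota ltnn; apply.
  apply/allP => _ /mapP[i _ ->]; apply/rootP.
  have i0 : 0 < (i.+2%:R : R)^-1 by rewrite invr_gt0 ltr0n.
  have i1 : (i.+2%:R : R)^-1 < 1 by rewrite invf_lt1 ?ltr0n // ltr1n.
  have iN : -1 <= (i.+2%:R : R)^-1 by apply: le_trans (ltW i0); rewrite lerN10.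
  rewrite -[_^-1](@acosK R) ?in_itv /= ?iN ?ltW //; apply: H.
  rewrite sin_acos ?iN ?ltW // gt_eqF // sqrtr_gt0 subr_gt0.
  by rewrite expr_lt1 // ltW.
rewrite map_inj_uniq ?iota_uniq // => i j /invr_inj/eqP.
by rewrite eqr_nat => /eqP[].
Qed.

Lemma is_chebyshevU_uniq n (u v : {poly R}) :
  is_chebyshevU n u -> is_chebyshevU n v -> u = v.
Proof.
move=> hu hv; apply/eqP; rewrite -subr_eq0; apply/eqP/poly_cos_eq0 => t st.
by rewrite hornerD hornerN hu // hv // subrr.
Qed.

Lemma chebyshevU0 : chebyshevU R 0 = 1.
Proof.
apply: (is_chebyshevU_uniq (@chebyshevUP R 0)) => t st.
by rewrite hornerE mul1r divff.
Qed.

Lemma chebyshevU1 : chebyshevU R 1 = 'X *+ 2.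
Proof.
apply: (is_chebyshevU_uniq (@chebyshevUP R 1)) => t st.
rewrite hornerMn hornerX mulr_natl [t *+ 2]mulr2n sinD.
by field.
Qed.

Lemma chebyshevUSS n :
  chebyshevU R n.+2 = 'X *+ 2 * chebyshevU R n.+1 - chebyshevU R n.
Proof.
apply: (is_chebyshevU_uniq (@chebyshevUP R n.+2)) => t st.
rewrite hornerD hornerN hornerM hornerMn hornerX !chebyshevUP // mulrA -mulrBl.
congr (_ / _).
have -> : n.+3%:R * t = n.+2%:R * t + t by rewrite -[n.+3%:R]natr1; ring.
have -> : n.+1%:R * t = n.+2%:R * t - t by rewrite -[n.+2%:R]natr1; ring.
by rewrite sinB sinD; ring.
Qed.

Notation x := (fracX R).
Notation y := ((1 - x) / (2 * x)).
Notation cf := (chebyshevU_frac R).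

Lemma fracX_neq0 : x != 0.
Proof. by rewrite tofrac_eq0 polyX_eq0. Qed.

Lemma frac2_neq0 : (2 : {fraction {poly R}}) != 0.
Proof.
rewrite -(rmorph_nat (@tofrac {poly R})) tofrac_eq0 -(rmorph_nat (@polyC R)).
by rewrite polyC_eq0 pnatr_eq0.
Qed.

(* with [map_poly] applied to a manifest ring morphism *)
Lemma chebyshevU_fracE n :
  cf n = (map_poly (@tofrac {poly R} \o polyC) (chebyshevU R n)).[y].
Proof. by []. Qed.

Lemma chebyshevU_frac0 : cf 0 = 1.
Proof. by rewrite chebyshevU_fracE chebyshevU0 rmorph1 hornerC. Qed.

Lemma two_y : y *+ 2 = (1 - x) / x.
Proof.
by rewrite invfM mulrA -mulrnAl -mulr_natr mulfVK // frac2_neq0.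
Qed.

Lemma chebyshevU_frac1 : cf 1 = (1 - x) / x.
Proof.
rewrite chebyshevU_fracE chebyshevU1 rmorphMn /= map_polyX.
by rewrite hornerMn hornerX two_y.
Qed.

Lemma chebyshevU_fracSS n : cf n.+2 = (1 - x) / x * cf n.+1 - cf n.
Proof.
rewrite !chebyshevU_fracE chebyshevUSS rmorphB rmorphM rmorphMn /= map_polyX.
by rewrite hornerD hornerN hornerM hornerMn hornerX two_y.
Qed.

(** Multiplied by the power of x that clears denominators, the three-term
    recurrence of the Chebyshev polynomials at (1 - x) / 2x becomes that of the
    determinants of the strips. *)
Lemma tofrac_strip_poly j : tofrac (strip_poly R j) = x ^+ j * cf j.
Proof.
have x0 := fracX_neq0.
suff [] : tofrac (strip_poly R j) = x ^+ j * cf j /\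
          tofrac (strip_poly R j.+1) = x ^+ j.+1 * cf j.+1 by [].
elim: j => [|j [IH1 IH2]].
  rewrite /= rmorph1 rmorphB rmorph1 chebyshevU_frac0 chebyshevU_frac1.
  rewrite mulr1 expr1.
  by split=> //; rewrite mulrCA mulfV ?mulr1.
split=> //; rewrite chebyshevU_fracSS -strip_step // -IH1 -IH2.
rewrite strip_polySS -(rmorph1 (@tofrac {poly R})).
by rewrite -rmorphB -rmorphXn -!rmorphM -rmorphB.
Qed.

Lemma tofrac_strip_den k :
  tofrac (strip_den R k) = x ^+ k.+1 * (cf k.+1 + cf k).
Proof.
rewrite mulrDr -tofrac_strip_poly exprS -mulrA -tofrac_strip_poly.
by rewrite -rmorphM -rmorphD.
Qed.

End Chebyshev.

(** * The formula in terms of Chebyshev polynomials *)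

(** The product is taken one height further than [dl_coef] goes: a path may
    climb to height k + b + 1, but only to descend again. *)
Lemma profile_coef_dl k b (d l : 'I_b.+1 -> nat) :
  profile_coef k (k + b.+2) k (at_height k d) (at_height k l) = dl_coef d l.
Proof.
rewrite /profile_coef /dl_coef addnS big_nat_recr ?leq_addr //=.
rewrite !at_height_out ?addnS // {2}/arrangements !addn0 !bin0 !muln1.
rewrite -{1}[k]add0n big_addn -addnS addKn big_mkord.
apply: eq_bigr => i _; rewrite [(i + k)%N]addnC !at_heightE /arrangements.
congr ('C(_ - 1, _) * _)%N; rewrite addnAC; congr (_ + _ + _)%N.
rewrite /boxes /dprev; case: i => [[|i]] ib /=; first by rewrite addn0 eqxx.
have -> : (k + i.+1 == k) = false by lia.
have -> : (k + i.+1 <= k)%N = false by lia.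
rewrite addn0 addnS /=; have /= -> := at_heightE k d (Ordinal (ltnW ib)).
by congr d; apply: val_inj; rewrite /= inordK // ltnW.
Qed.

Lemma profile_size_dl k b (d l : 'I_b.+1 -> nat) :
  profile_size k (k + b.+2) (at_height k d) (at_height k l)
  = (\sum_(j < b.+1) (2 * d j + l j))%N.
Proof.
rewrite /profile_size addnS big_nat_recr ?leq_addr //=.
rewrite !at_height_out ?addnS // !addn0.
rewrite -{1}[k]add0n big_addn -addnS addKn big_mkord.
by apply: eq_bigr => i _; rewrite [(i + k)%N]addnC !at_heightE.
Qed.

Lemma exponent_identity (F : fieldType) (c x u v : F) (k N W : nat) :
  x != 0 -> u != 0 -> v != 0 ->
  c * x ^+ (W + 2 * k) * (x ^+ k * u) ^+ N
     / ((x ^+ k * u) * (x ^+ k.+1 * v) ^+ N.+1)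
  = c * (u ^ (N%:Z - 1) / v ^ (N%:Z + 1)) * x ^ (- 1 - N%:Z + W%:Z).
Proof.
move=> x0 u0 v0.
have -> : u ^ (N%:Z - 1) = u ^+ N / u by rewrite expfzDr.
have -> : v ^ (N%:Z + 1) = v ^+ N.+1 by rewrite -PoszD addn1.
have -> : x ^ (- 1 - N%:Z + W%:Z) = x ^+ W / x ^+ N.+1.
  by rewrite addrC expfzDr // -opprD -PoszD add1n.
have e : x ^+ k * (x ^+ k.+1) ^+ N.+1
         = x ^+ (2 * k) * (x ^+ k) ^+ N * x ^+ N.+1.
  by rewrite -!exprM -!exprD; congr (_ ^+ _); lia.
have -> : x ^+ k * u * (x ^+ k.+1 * v) ^+ N.+1 =
    (x ^+ (2 * k) * (x ^+ k) ^+ N * x ^+ N.+1) * (u * v ^+ N.+1).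
  by rewrite -e exprMn; ring.
rewrite exprD [(x ^+ k * u) ^+ N]exprMn.
have := expf_neq0 N.+1 x0; have := expf_neq0 N.+1 v0.
have := expf_neq0 N (expf_neq0 k x0); have := expf_neq0 (2 * k) x0.
(* powers with symbolic exponents become indeterminates *)
move: (x ^+ (2 * k)) ((x ^+ k) ^+ N) (x ^+ N.+1) (x ^+ W) (u ^+ N) (v ^+ N.+1).
move=> a1 a2 a3 a4 a5 a6 h1 h2 h3 h4; field.
by rewrite h1 h2 h3 h4 u0.
Qed.

Lemma strip_poly_coef0 (R : comNzRingType) j : (strip_poly R j)`_0 = 1.
Proof.
suff [] : (strip_poly R j)`_0 = 1 /\ (strip_poly R j.+1)`_0 = 1 by [].
elim: j => [|j [IH1 IH2]].
  by rewrite /= coefB coefX !coef1 subr0.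
split=> //; rewrite strip_polySS coefB !coef0M coefB !coefX coef1 IH2.
by rewrite !mul0r !subr0 mulr1.
Qed.

Lemma strip_poly_neq0 (R : comNzRingType) j : strip_poly R j != 0.
Proof.
apply/eqP => /(congr1 (fun p : {poly R} => p`_0)) /eqP.
by rewrite strip_poly_coef0 coef0 oner_eq0.
Qed.

Lemma strip_den_neq0 (R : comNzRingType) k : strip_den R k != 0.
Proof.
apply/eqP => /(congr1 (fun p : {poly R} => p`_0)) /eqP.
by rewrite coefD coef0M coefX mul0r addr0 strip_poly_coef0 coef0 oner_eq0.
Qed.

Lemma rational_term (R : realType) k c N W :
  c%:R * (chebyshevU_frac R k ^ (N%:Z - 1) /
          (chebyshevU_frac R k.+1 + chebyshevU_frac R k) ^ (N%:Z + 1))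
    * fracX R ^ (- 1 - N%:Z + W%:Z)
  = tofrac (c%:R * 'X^(W + 2 * k) * strip_poly R k ^+ N)
    / tofrac (strip_poly R k * strip_den R k ^+ N.+1).
Proof.
have u0 : chebyshevU_frac R k != 0.
  have := strip_poly_neq0 R k; rewrite -tofrac_eq0 tofrac_strip_poly mulf_eq0.
  by rewrite negb_or => /andP[].
have v0 : chebyshevU_frac R k.+1 + chebyshevU_frac R k != 0.
  have := strip_den_neq0 R k; rewrite -tofrac_eq0 tofrac_strip_den mulf_eq0.
  by rewrite negb_or => /andP[].
rewrite -(exponent_identity _ k N W (fracX_neq0 R) u0 v0).
rewrite -tofrac_strip_poly -tofrac_strip_den -!rmorphXn.
rewrite -(rmorph_nat (@tofrac {poly R})).
by rewrite -!rmorphM.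
Qed.

Theorem theorem4p3 (R : realType) (r k b : nat)
  (hr : (1 <= r)%N) (hk : (1 <= k)%N)
  (hrb : ('C(2 * k + 2 * b, 2 * k) <= r < 'C(2 * k + 2 * b + 2, 2 * k))%N) :
  is_power_series
    (fun n : nat => (I3412_count (2 * k + 1) r n)%:R : R)
    (\sum_(d : {ffun 'I_b.+1 -> 'I_r.+1})
      \sum_(l : {ffun 'I_b.+1 -> 'I_r.+1} |
              r == dl_weight k (fun i => d i : nat) (fun i => l i : nat))
        (dl_coef (fun i => d i : nat) (fun i => l i : nat))%:R
        * (chebyshevU_frac R k ^ ((d ord0)%:Z + (l ord0)%:Z - 1)
           / (chebyshevU_frac R k.+1 + chebyshevU_frac R k)
               ^ ((d ord0)%:Z + (l ord0)%:Z + 1))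
        * fracX R ^ (- 1 - (d ord0)%:Z - (l ord0)%:Z
                     + \sum_(j < b.+1) (2 * (d j)%:Z + (l j)%:Z))).
Proof.
have [_ rb] := andP hrb.
have -> : (fun n : nat => (I3412_count (2 * k + 1) r n)%:R : R) = (fun n =>
   \sum_(d : {ffun 'I_b.+1 -> 'I_r.+1})
    \sum_(l : {ffun 'I_b.+1 -> 'I_r.+1} |
            r == dl_weight k (fun i => d i : nat) (fun i => l i : nat))
      (count_profile k n 0 (at_height k (fun i => d i : nat))
        (at_height k (fun i => l i : nat)))%:R).
  apply/funext => n; rewrite (I3412_count_by_profile _ rb) natr_sum.
  by apply: eq_bigr => d _; rewrite natr_sum.
apply: is_power_series_sum => d _; apply: is_power_series_sum => l /eqP rE.
set d' := fun i => d i : nat; set l' := fun i => l i : nat.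
pose D := at_height k d'; pose L := at_height k l'.
have D0 : D k = d ord0.
  by rewrite /D -[X in at_height _ _ X]addn0 (at_heightE k d' ord0).
have L0 : L k = l ord0.
  by rewrite /L -[X in at_height _ _ X]addn0 (at_heightE k l' ord0).
have nz : ~~ zero_profile k D L.
  apply/negP => /asboolP z; suff r0 : r = 0%N by rewrite r0 in hr.
  have zd i : d i = 0%N :> nat /\ l i = 0%N :> nat.
    by have := z (k + i)%N (leq_addr _ _); rewrite /D /L !at_heightE.
  by rewrite rE /dl_weight !big1 // => i _; have [e1 e2] := zd i; rewrite ?e1 ?e2.
have supp x : (k + b.+2 <= x.+1)%N -> D x = 0%N /\ L x = 0%N.
  by move=> h; rewrite /D /L !at_height_out //; lia.
have kK : (k < k + b.+2)%N by lia.
apply/is_power_seriesP.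
exists ((dl_coef d' l')%:R * 'X^(\sum_(j < b.+1) (2 * d' j + l' j) + 2 * k)%N
    * strip_poly R k ^+ (d ord0 + l ord0)),
  (strip_poly R k * strip_den R k ^+ (d ord0 + l ord0).+1); split.
- by rewrite mulf_neq0 ?expf_neq0 ?strip_poly_neq0 ?strip_den_neq0.
- rewrite -rational_term PoszD opprD addrA; congr (_ * _ * _ ^ (_ + _)).
  by elim/big_ind2: _ => // m1 n1 m2 n2 -> ->; rewrite PoszD.
have := profile_series_from0 R hk kK supp nz.
by rewrite D0 L0 profile_coef_dl profile_size_dl.
Qed.
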